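(* Let $a,b>0$ with $a+b\leq 1$, and let $c\geq 0$. Define on $(0,1)$ $$\varphi_{a,b,c}(x)=\frac{c-\log(1-x)}{{}_2F_1(a,b;a+b;x)}.$$ Then $\varphi_{a,b,c}$ is strictly convex on $(0,1)$ if and only if $c\leq R(a,b)$, and $\varphi_{a,b,c}$ is strictly concave on $(0,1)$ if and only if $c\geq c(a,b)$, where $$c(a,b)=\frac{(a+b)(a+b-2ab)(a+b+1)}{ab\big((a+b+1)(a+b-2ab)+ab(a+b)\big)}.$$
   Context: ${}_2F_1(a,b;c;x)=\sum_{n\geq0}\frac{(a)_n(b)_n}{(c)_n}\frac{x^n}{n!}$ is the Gauss hypergeometric function, with $(a)_n=\Gamma(a+n)/\Gamma(a)$ the Pochhammer symbol. $\psi=\Gamma'/\Gamma$ is the digamma function, $\gamma=-\psi(1)$ the Euler–Mascheroni constant, and $R(a,b)=-2\gamma-\psi(a)-\psi(b)$ (the Ramanujan constant). *)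

(* Defs.v *)
From Stdlib Require Import Reals Lra Factorial.
From Coquelicot Require Import Coquelicot.
Open Scope R_scope.

Fixpoint poch (a : R) (n : nat) : R :=
  match n with
  | O => 1
  | S k => poch a k * (a + INR k)
  end.

Definition hyp2F1 (a b c x : R) : R :=
  Series (fun n => poch a n * poch b n / poch c n * x ^ n / INR (Factorial.fact n)).

Definition Gamma (x : R) : R :=
  RInt_gen (fun t => Rpower t (x - 1) * exp (- t))
           (at_right 0) (Rbar_locally p_infty).

Definition digamma (x : R) : R := Derive Gamma x / Gamma x.

Definition euler_gamma : R := - digamma 1.

Definition ramanujanR (a b : R) : R := - 2 * euler_gamma - digamma a - digamma b.

Definition cab (a b : R) : R :=
  (a + b) * (a + b - 2 * a * b) * (a + b + 1) /
  (a * b * ((a + b + 1) * (a + b - 2 * a * b) + a * b * (a + b))).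

Definition phi (a b c x : R) : R := (c - ln (1 - x)) / hyp2F1 a b (a + b) x.

Definition strictly_convex_01 (f : R -> R) : Prop :=
  forall x y t, 0 < x < 1 -> 0 < y < 1 -> x <> y -> 0 < t < 1 ->
    f (t * x + (1 - t) * y) < t * f x + (1 - t) * f y.

Definition strictly_concave_01 (f : R -> R) : Prop :=
  forall x y t, 0 < x < 1 -> 0 < y < 1 -> x <> y -> 0 < t < 1 ->
    t * f x + (1 - t) * f y < f (t * x + (1 - t) * y).

(* Main.v *)
Require Import Defs.
From Stdlib Require Import Reals Lra Lia.
From Coquelicot Require Import Coquelicot.
Open Scope R_scope.

(** Write [p = a + b], [q = a b], [F] for the hypergeometric function,
    [T = (1 - x) F'], [w = T / F] and [L = - ln (1 - x)]. In the variable [t = L]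
    the hypergeometric equation is the Riccati equation
    [w' + w^2 = (q - p w) / (e^t - 1)], and [phi''] is a positive multiple of
    [H - c], where [1 / (H + L) = w + (q - p w) / ((e^t - 1) (1 - 2 w))].
    The sign of [H'] is opposite to that of [(e^t - 1) - Z(w)] for an explicit
    rational function [Z]. This difference vanishes at 0, and whenever it is nonpositive
    [e^(-t) ((e^t - 1) - Z(w))] has positive derivative, because the relevant
    cubic in [w] factors into positive linear factors; hence [H' < 0].
    So the range of [H] is the open interval between its limit at 1 and
    its limit [cab a b] at 0.

    The limit at 1 is the constant in [F / C = L + Rhat + o(1)], where [C] is the
    limit of [n] times the [n]-th coefficient of [F]. A telescoping sum gives
    [Rhat (a + 1, b) = Rhat (a, b) - 1 / a]; together with monotonicity in [a] and
    [b] and [Rhat (1, 1) = 0] this determines [Rhat]. The Ramanujan constant has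
    the same characterization, which needs only the recurrence and the log-convexity
    of [Gamma]. *)

(** * The Gamma and digamma functions *)

(** The quantity [H] comes from the identity [(1 - x)^2 F phi'' = (1 - 2 w) - (c + L) ((1 - 2 w) w +
    (1 - x) T' / F)]: dividing by the coefficient of [c + L] leaves [H - c]. The formal proof stays
    in the variable [x], where [e^t - 1] is [x / (1 - x)] and [e^(-t)] is [1 - x]. The bound
    [a + b <= 1] acts through [4 q <= p^2] and [p w < q] on the open interval: they give
    [4 w < p <= 1], which keeps [1 - 2 w] and the linear factors of the cubic positive. The limit of
    [H] at 1 is delicate because [L] is unbounded and multiplies the error in [T / C -> 1]. That
    error is therefore needed with a rate; [sqrt (1 - x)] suffices, since [L sqrt (1 - x)] tends to
    0. Sufficiency includes the limiting values of [c] because [H] never attains its limits. For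
    necessity, a [c] strictly beyond a limit fixes the wrong sign of [phi''] on an interval next to
    that endpoint, which already contradicts convexity or concavity there. *)

Lemma exp_ge_tangent (m z : R) : exp m * (1 + (z - m)) <= exp z.
Proof.
replace z with (m + (z - m)) at 2 by ring.
rewrite exp_plus; apply Rmult_le_compat_l; [left; apply exp_pos|].
destruct (Req_dec (z - m) 0) as [->|H]; [rewrite exp_0; lra|].
left; apply exp_ineq1; assumption.
Qed.

Lemma exp_convex (A B th : R) (hth : 0 <= th <= 1) :
  exp ((1 - th) * A + th * B) <= (1 - th) * exp A + th * exp B.
Proof.
set (m := (1 - th) * A + th * B).
assert (HA := exp_ge_tangent m A); assert (HB := exp_ge_tangent m B).
assert ((1 - th) * (exp m * (1 + (A - m))) + th * (exp m * (1 + (B - m))) = exp m)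
  by (unfold m; ring).
nra.
Qed.

Lemma ln_le_sub_1 (y : R) (hy : 0 < y) : ln y <= y - 1.
Proof.
assert (H := exp_ge_tangent 0 (ln y)); rewrite exp_ln, exp_0 in H; lra.
Qed.

Lemma ln_ge_1_sub_inv (y : R) (hy : 0 < y) : 1 - / y <= ln y.
Proof.
assert (H := ln_le_sub_1 (/ y) (Rinv_0_lt_compat _ hy)).
rewrite ln_Rinv in H; lra.
Qed.

(** The value is the supremum of the integrals over compact intervals. By positivity the integral
    grows with the interval, so one interval within [eps] of the supremum controls every larger
    one. *)
Lemma is_RInt_gen_pos (f : R -> R) (M : R)
  (hc : forall t, 0 < t -> continuous f t)
  (hp : forall t, 0 < t -> 0 < f t)
  (hM : forall u v, 0 < u -> u <= v -> RInt f u v <= M) :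
  exists l, 0 < l /\ is_RInt_gen f (at_right 0) (Rbar_locally p_infty) l.
Proof.
assert (hex : forall u v, 0 < u -> u <= v -> ex_RInt f u v).
{ intros u v Hu Huv; apply (ex_RInt_continuous f); intros z Hz.
  rewrite Rmin_left in Hz by lra; apply hc; lra. }
assert (hge : forall u v, 0 < u -> u <= v -> 0 <= RInt f u v).
{ intros u v Hu Huv; apply RInt_ge_0; auto.
  intros t Ht; left; apply hp; lra. }
assert (hmono : forall u u0 v0 v, 0 < u -> u <= u0 -> u0 <= v0 -> v0 <= v ->
  RInt f u0 v0 <= RInt f u v).
{ intros u u0 v0 v H1 H2 H3 H4.
  rewrite <- (RInt_Chasles f u u0 v) by (apply hex; lra).
  rewrite <- (RInt_Chasles f u0 v0 v) by (apply hex; lra).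
  assert (G1 := hge u u0 ltac:(lra) ltac:(lra)).
  assert (G2 := hge v0 v ltac:(lra) ltac:(lra)).
  unfold plus; simpl; lra. }
set (E := fun y => exists u v, 0 < u /\ u <= v /\ y = RInt f u v).
destruct (completeness E) as [l [Hub Hlub]].
{ exists M; intros y (u & v & Hu & Huv & ->); auto. }
{ exists (RInt f 1 2), 1, 2; repeat split; lra. }
exists l; split.
{ apply Rlt_le_trans with (RInt f 1 2).
  - apply RInt_gt_0; [lra| intros; apply hp; lra |intros; apply hc; lra].
  - apply Hub; exists 1, 2; repeat split; lra. }
apply (filterlimi_lim_ext_loc (fun ab => RInt f (fst ab) (snd ab))).
{ exists (fun u => 0 < u < 1) (fun v => 1 < v).
  - exists (mkposreal 1 Rlt_0_1); intros y Hy Hy0.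
    apply Rabs_lt_between' in Hy; simpl in Hy; lra.
  - exists 1; auto.
  - intros u v Hu Hv; simpl; apply (RInt_correct f u v); apply hex; lra. }
apply filterlim_locally; intros eps.
assert (exists u0 v0, 0 < u0 /\ u0 <= v0 /\ l - eps < RInt f u0 v0) as (u0 & v0 & H0 & H1 & H2).
{ apply Classical_Prop.NNPP; intros Hn.
  assert (l <= l - eps); [|destruct eps; simpl in *; lra].
  apply Hlub; intros y (u & v & Hu & Huv & ->).
  apply Rnot_lt_le; intros Hlt; apply Hn; exists u, v; auto. }
exists (fun u => 0 < u < u0) (fun v => v0 < v).
- exists (mkposreal u0 H0); intros y Hy Hy0.
  apply Rabs_lt_between' in Hy; simpl in Hy; lra.
- exists v0; auto.
- intros u v Hu Hv; simpl; apply Rabs_lt_between'; split.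
  + apply Rlt_le_trans with (1 := H2), hmono; lra.
  + apply Rle_lt_trans with l; [|destruct eps; simpl; lra].
    apply Hub; exists u, v; repeat split; lra.
Qed.

(** * Convergence, recurrence and log-convexity of the Gamma integral *)

Definition gamma_integrand (x t : R) : R := Rpower t (x - 1) * exp (- t).

Lemma gamma_integrand_exp (x t : R) :
  gamma_integrand x t = exp ((x - 1) * ln t - t).
Proof. unfold gamma_integrand, Rpower; rewrite <- exp_plus; f_equal; ring. Qed.

Lemma continuous_gamma_integrand (x t : R) (ht : 0 < t) :
  continuous (gamma_integrand x) t.
Proof.
apply (ex_derive_continuous (gamma_integrand x)).
eapply ex_derive_ext; [intros; symmetry; apply gamma_integrand_exp|].
auto_derive; assumption.
Qed.

Lemma gamma_integrand_pos (x t : R) : 0 < gamma_integrand x t.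
Proof. rewrite gamma_integrand_exp; apply exp_pos. Qed.

Lemma gamma_integrand_S (x t : R) (ht : 0 < t) :
  gamma_integrand (x + 1) t = t * gamma_integrand x t.
Proof.
rewrite !gamma_integrand_exp.
replace ((x + 1 - 1) * ln t - t) with (ln t + ((x - 1) * ln t - t)) by ring.
rewrite exp_plus, exp_ln by assumption; reflexivity.
Qed.

Lemma is_derive_gamma_integrand_S (x t : R) (ht : 0 < t) :
  is_derive (gamma_integrand (x + 1)) t
    (x * gamma_integrand x t - gamma_integrand (x + 1) t).
Proof.
eapply is_derive_ext; [intros; symmetry; apply gamma_integrand_exp|].
replace (x * gamma_integrand x t - gamma_integrand (x + 1) t)
  with ((x * / t - 1) * gamma_integrand (x + 1) t)
  by (rewrite gamma_integrand_S by assumption; field; lra).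
rewrite gamma_integrand_exp; auto_derive; [assumption|]; unfold Rminus; field; lra.
Qed.

(** The maximum over [t > 0] of [t^x exp (- t / 2)], attained at [t = 2 x]. *)
Definition gamma_bound (x : R) : R := exp (x * ln (2 * x) - x).

Lemma gamma_integrand_S_le (x t : R) (hx : 0 < x) (ht : 0 < t) :
  gamma_integrand (x + 1) t <= gamma_bound x * exp (- (t / 2)).
Proof.
rewrite gamma_integrand_exp; unfold gamma_bound; rewrite <- exp_plus.
assert (H : ln (t * / (2 * x)) <= t * / (2 * x) - 1)
  by (apply ln_le_sub_1, Rmult_lt_0_compat; [assumption | apply Rinv_0_lt_compat; lra]).
rewrite ln_mult, ln_Rinv in H by (try apply Rinv_0_lt_compat; lra).
assert (x * (ln t + - ln (2 * x)) <= x * (t * / (2 * x) - 1))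
  by (apply Rmult_le_compat_l; lra).
replace (x * (t * / (2 * x) - 1)) with (t / 2 - x) in H0 by (field; lra).
destruct (Rle_lt_or_eq_dec ((x + 1 - 1) * ln t - t) (x * ln (2 * x) - x + - (t / 2))) as [h|h].
- lra.
- left; apply exp_increasing; assumption.
- right; f_equal; assumption.
Qed.

(* Integration by parts turns the singular factor [t^(x-1)] at 0 into [t^x / x],
   so the integral over every [u, v] has a common bound. *)
Lemma RInt_gamma_integrand_le (x u v : R) (hx : 0 < x) (hu : 0 < u) (huv : u <= v) :
  RInt (gamma_integrand x) u v <= 3 * gamma_bound x / x.
Proof.
set (M := gamma_bound x).
assert (HM : 0 < M) by apply exp_pos.
(* The exponential term of [P'] outweighs the remainder [t^x exp (- t) / x] of the integration by
   parts. Hence [P'] dominates the integrand and still has the explicit primitive [P]. The factor 3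
   is 1 from the value at [v] plus 2 from the exponential at [u]. *)
set (P := fun t => gamma_integrand (x + 1) t / x - 2 * M / x * exp (- (t / 2))).
set (P' := fun t => gamma_integrand x t - gamma_integrand (x + 1) t / x
                    + M / x * exp (- (t / 2))).
assert (HI : is_RInt P' u v (minus (P v) (P u))).
{ apply (is_RInt_derive P P'); intros t Ht; rewrite Rmin_left in Ht by lra.
  - unfold P, P'.
    replace (gamma_integrand x t - gamma_integrand (x + 1) t / x + M / x * exp (- (t / 2)))
      with (minus (scal (/ x) (x * gamma_integrand x t - gamma_integrand (x + 1) t))
       (2 * M / x * (- (1/2) * exp (- (t / 2)))))
      by (unfold minus, plus, opp, scal; simpl; unfold mult; simpl; field; lra).
    apply (is_derive_minus (fun t => gamma_integrand (x + 1) t / x)).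
    + apply is_derive_ext with (fun t => scal (/ x) (gamma_integrand (x + 1) t)).
      { intros; unfold scal; simpl; unfold mult; simpl; field; lra. }
      apply (is_derive_scal (gamma_integrand (x + 1))).
      apply is_derive_gamma_integrand_S; lra.
    + auto_derive; [trivial|lra].
  - unfold P'; apply (continuous_plus (fun t => gamma_integrand x t - gamma_integrand (x + 1) t / x)).
    + apply (continuous_minus (gamma_integrand x)).
      * apply continuous_gamma_integrand; lra.
      * apply (continuous_mult (gamma_integrand (x + 1)) (fun _ => / x)).
        -- apply continuous_gamma_integrand; lra.
        -- apply continuous_const.
    + apply ex_derive_continuous; auto_derive; trivial. }
assert (Hex : ex_RInt (gamma_integrand x) u v).
{ apply (ex_RInt_continuous (gamma_integrand x)); intros t Ht.
  rewrite Rmin_left in Ht by lra; apply continuous_gamma_integrand; lra. }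
assert (H : RInt (gamma_integrand x) u v <= minus (P v) (P u)).
{ apply is_RInt_le with (gamma_integrand x) P' u v; auto.
  - apply (RInt_correct (gamma_integrand x)); assumption.
  - intros t Ht; unfold P'.
    assert (H := gamma_integrand_S_le x t hx ltac:(lra)); fold M in H.
    assert (gamma_integrand (x + 1) t / x <= M * exp (- (t / 2)) / x)
      by (apply Rmult_le_compat_r; [left; apply Rinv_0_lt_compat|]; assumption).
    lra. }
apply Rle_trans with (1 := H).
unfold minus, plus, opp, P; simpl.
assert (Hi : 0 < / x) by (apply Rinv_0_lt_compat; assumption).
assert (Hb : forall t, 0 < t -> exp (- (t / 2)) <= 1).
{ intros t Ht; rewrite <- exp_0; left; apply exp_increasing; lra. }
assert (H1 := gamma_integrand_S_le x v hx ltac:(lra)); fold M in H1.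
assert (H2 := gamma_integrand_pos (x + 1) u).
assert (H3 := Hb v ltac:(lra)); assert (H4 := Hb u ltac:(lra)).
assert (H5 := exp_pos (- (v / 2))); assert (H6 := exp_pos (- (u / 2))).
assert (gamma_integrand (x + 1) v <= M) by nra.
assert (gamma_integrand (x + 1) v - gamma_integrand (x + 1) u
  - 2 * M * exp (- (v * / 2)) + 2 * M * exp (- (u * / 2)) <= 3 * M).
{ unfold Rdiv in *; nra. }
apply Rmult_le_compat_r with (r := / x) in H7; [|lra].
unfold Rdiv in *; nra.
Qed.

Lemma is_RInt_gen_Gamma (x : R) (hx : 0 < x) :
  0 < Gamma x /\
  is_RInt_gen (gamma_integrand x) (at_right 0) (Rbar_locally p_infty) (Gamma x).
Proof.
destruct (is_RInt_gen_pos (gamma_integrand x) (3 * gamma_bound x / x)) as (l & Hl & HI).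
- apply continuous_gamma_integrand.
- intros; apply gamma_integrand_pos.
- intros; apply RInt_gamma_integrand_le; assumption.
- replace (Gamma x) with l; [split; assumption|].
  symmetry; apply (is_RInt_gen_unique (gamma_integrand x)), HI.
Qed.

Lemma Gamma_pos (x : R) (hx : 0 < x) : 0 < Gamma x.
Proof. apply is_RInt_gen_Gamma; assumption. Qed.

(** The derivative of [t^x exp (- t)] is integrated in two ways: by its boundary values, which
    vanish at 0 and at infinity, and by linearity. *)
Lemma Gamma_S (x : R) (hx : 0 < x) : Gamma (x + 1) = x * Gamma x.
Proof.
destruct (is_RInt_gen_Gamma x hx) as [_ H0].
destruct (is_RInt_gen_Gamma (x + 1) ltac:(lra)) as [_ H1].
set (f := gamma_integrand (x + 1)).
assert (HD : forall t, 0 < t -> Derive f t = x * gamma_integrand x t - gamma_integrand (x + 1) t).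
{ intros; apply is_derive_unique, is_derive_gamma_integrand_S; assumption. }
assert (Hb : filter_prod (at_right 0) (Rbar_locally p_infty)
    (fun ab => 0 < Rmin (fst ab) (snd ab))).
{ exists (fun u => 0 < u) (fun v => 0 < v).
  - exists (mkposreal 1 Rlt_0_1); intros; assumption.
  - exists 0; auto.
  - intros u v Hu Hv; simpl; apply Rmin_glb_lt; assumption. }
assert (HI : is_RInt_gen (Derive f) (at_right 0) (Rbar_locally p_infty) (0 - 0)).
{ apply is_RInt_gen_Derive.
  - revert Hb; apply filter_imp; intros [u v] H t Ht.
    eexists; apply is_derive_gamma_integrand_S; lra.
  - revert Hb; apply filter_imp; intros [u v] H t Ht.
    apply continuous_ext_loc with (fun t => minus (scal x (gamma_integrand x t)) (gamma_integrand (x + 1) t)).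
    + assert (Ht0 : 0 < t) by (simpl in *; lra).
      exists (mkposreal t Ht0); intros y Hy.
      apply Rabs_lt_between' in Hy; simpl in Hy.
      rewrite HD by lra; reflexivity.
    + apply (continuous_minus (fun t => scal x (gamma_integrand x t))).
      * apply (continuous_scal_r x (gamma_integrand x)), continuous_gamma_integrand; simpl in *; lra.
      * apply continuous_gamma_integrand; simpl in *; lra.
  - apply filterlim_locally; intros eps.
    (* The witness is the [x]-th root of [eps]; below it [t^x exp (- t) < t^x < eps]. *)
    exists (mkposreal _ (exp_pos (ln eps / x))); intros t Ht Ht0.
    apply Rabs_lt_between' in Ht; simpl in Ht.
    apply Rabs_lt_between'.
    assert (Hp := gamma_integrand_pos (x + 1) t); fold f in Hp.
    split; [destruct eps; simpl in *; lra|].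
    unfold f; rewrite gamma_integrand_exp, Rplus_0_l.
    destruct eps as [e He]; simpl in *; rewrite <- (exp_ln e He).
    apply exp_increasing.
    assert (Hl : ln t < ln e / x) by (rewrite <- (ln_exp (ln e / x)); apply ln_increasing; lra).
    apply Rmult_lt_compat_r with (r := x) in Hl; [|assumption].
    unfold Rdiv in Hl; rewrite Rmult_assoc, Rinv_l in Hl by lra; lra.
  - apply filterlim_locally; intros [e He].
    set (M := gamma_bound x); assert (HM : 0 < M) by apply exp_pos.
    exists (Rmax 0 (-2 * ln (e / M))); intros t Ht.
    assert (Ht0 : 0 < t) by (eapply Rle_lt_trans; [apply Rmax_l | exact Ht]).
    assert (Ht1 : -2 * ln (e / M) < t) by (eapply Rle_lt_trans; [apply Rmax_r | exact Ht]).
    assert (Hp := gamma_integrand_pos (x + 1) t); fold f in Hp.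
    apply Rabs_lt_between'; simpl; split; [lra|].
    rewrite Rplus_0_l; apply Rle_lt_trans with (1 := gamma_integrand_S_le x t hx Ht0); fold M.
    assert (exp (- (t / 2)) < e / M).
    { rewrite <- (exp_ln (e / M)) by (apply Rdiv_lt_0_compat; assumption).
      apply exp_increasing; lra. }
    apply Rmult_lt_compat_l with (r := M) in H; [|assumption].
    replace (M * (e / M)) with e in H by (field; lra); assumption. }
assert (HI' : is_RInt_gen (Derive f) (at_right 0) (Rbar_locally p_infty)
   (minus (scal x (Gamma x)) (Gamma (x + 1)))).
{ apply is_RInt_gen_ext with (fun t => minus (scal x (gamma_integrand x t)) (gamma_integrand (x + 1) t)).
  - revert Hb; apply filter_imp; intros [u v] H t Ht.
    rewrite HD by (simpl in *; lra); reflexivity.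
  - exact (is_RInt_gen_minus _ _ _ _ (is_RInt_gen_scal _ x _ H0) H1). }
assert (E1 := is_RInt_gen_unique (Derive f) _ HI).
rewrite (is_RInt_gen_unique (Derive f) _ HI') in E1; clear HI'; rename E1 into HI'.
 unfold minus, plus, opp, scal in HI'; simpl in HI'; unfold mult in HI'; simpl in HI'.
lra.
Qed.

(** Hoelder's inequality through normalisation. Divide the integrand at [x] by
    [Gamma u ^ (1 - th) * Gamma v ^ th]; convexity of [exp] bounds it pointwise by the convex
    combination of the integrands at [u] and [v], each divided by its own integral. Integrating
    gives a quotient of at most 1. *)
Lemma Gamma_log_convex (u v th : R) (hu : 0 < u) (hv : 0 < v) (hth : 0 <= th <= 1) :
  ln (Gamma ((1 - th) * u + th * v)) <= (1 - th) * ln (Gamma u) + th * ln (Gamma v).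
Proof.
set (x := (1 - th) * u + th * v).
assert (hx : 0 < x) by (unfold x; nra).
set (k := (1 - th) * ln (Gamma u) + th * ln (Gamma v)).
destruct (is_RInt_gen_Gamma u hu) as [Pu Hu].
destruct (is_RInt_gen_Gamma v hv) as [Pv Hv].
destruct (is_RInt_gen_Gamma x hx) as [Px Hx].
assert (H : norm (scal (exp (- k)) (Gamma x)) <=
   plus (scal ((1 - th) * / Gamma u) (Gamma u)) (scal (th * / Gamma v) (Gamma v))).
{ apply (@RInt_gen_norm R_CompleteNormedModule (at_right 0) (Rbar_locally p_infty)
    (at_right_proper_filter 0) (Rbar_locally_filter p_infty)
    (fun t => scal (exp (- k)) (gamma_integrand x t))
    (fun t => plus (scal ((1 - th) * / Gamma u) (gamma_integrand u t))
                   (scal (th * / Gamma v) (gamma_integrand v t)))).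
  - exists (fun u => u < 1) (fun v => 1 < v).
    + exists (mkposreal 1 Rlt_0_1); intros y Hy Hy0.
      apply Rabs_lt_between' in Hy; simpl in Hy; lra.
    + exists 1; auto.
    + intros; simpl; lra.
  - apply filter_forall; intros [s r] t _.
    unfold scal, plus; simpl; unfold mult; simpl.
    rewrite Rabs_pos_eq by (left; apply Rmult_lt_0_compat; [apply exp_pos|apply gamma_integrand_pos]).
    rewrite <- (exp_ln (/ Gamma u)), <- (exp_ln (/ Gamma v)) by (apply Rinv_0_lt_compat; assumption).
    rewrite !ln_Rinv by assumption.
    rewrite !gamma_integrand_exp, !Rmult_assoc, <- !exp_plus.
    eapply Rle_trans; [|apply exp_convex; assumption].
    right; f_equal; unfold k, x; ring.
  - exact (is_RInt_gen_scal _ _ _ Hx).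
  - exact (is_RInt_gen_plus _ _ _ _ (is_RInt_gen_scal _ _ _ Hu) (is_RInt_gen_scal _ _ _ Hv)). }
unfold norm, scal, plus in H; simpl in H; unfold abs, mult in H; simpl in H.
rewrite !Rmult_assoc, !Rinv_l in H by lra.
rewrite Rabs_pos_eq in H by (left; apply Rmult_lt_0_compat; [apply exp_pos|assumption]).
assert (H' : exp (- k + ln (Gamma x)) <= exp 0).
{ rewrite exp_plus, exp_ln, exp_0 by assumption; lra. }
apply Rnot_lt_le; intros Hlt.
apply (Rlt_not_le _ _ (exp_increasing 0 (- k + ln (Gamma x)) ltac:(lra))); assumption.
Qed.

(** * The digamma function as a limit of logarithms minus sums of reciprocals *)

Fixpoint shift_sum (f : R -> R) (x : R) (n : nat) : R :=
  match n with
  | O => 0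
  | S k => shift_sum f x k + f (x + INR k)
  end.

Lemma shift_sum_S (f : R -> R) (x : R) (n : nat) :
  shift_sum f x (S n) = shift_sum f x n + f (x + INR n).
Proof. reflexivity. Qed.

Lemma ln_Gamma_S (x : R) (hx : 0 < x) : ln (Gamma (x + 1)) = ln (Gamma x) + ln x.
Proof. rewrite Gamma_S, ln_mult; auto using Gamma_pos; lra. Qed.

Lemma ln_Gamma_shift (x : R) (n : nat) (hx : 0 < x) :
  ln (Gamma (x + INR n)) = ln (Gamma x) + shift_sum ln x n.
Proof.
induction n as [|n IH]; simpl shift_sum.
- rewrite Rplus_0_r, Rplus_0_r; reflexivity.
- rewrite S_INR, <- Rplus_assoc, ln_Gamma_S, IH; [ring|].
  assert (H := pos_INR n); lra.
Qed.

(** By the recurrence the chords of [ln Gamma] over [[y - 1, y]] and [[y, y + 1]] have slopes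
    [ln (y - 1)] and [ln y]; convexity puts the slope over [[y, y + h]] between them. The weight
    [h / (1 + h)] is the one that expresses [y] through [y + h] and [y - 1]. *)
Lemma ln_Gamma_incr_bounds (y h : R) (hy : 1 < y) (hh : 0 < h <= 1) :
  h * ln (y - 1) <= ln (Gamma (y + h)) - ln (Gamma y) <= h * ln y.
Proof.
assert (S0 := ln_Gamma_S y ltac:(lra)).
assert (S1 := ln_Gamma_S (y - 1) ltac:(lra)).
replace (y - 1 + 1) with y in S1 by ring.
split.
- assert (H := Gamma_log_convex (y + h) (y - 1) (h / (1 + h)) ltac:(lra) ltac:(lra)).
  replace ((1 - h / (1 + h)) * (y + h) + h / (1 + h) * (y - 1)) with y in H by (field; lra).
  assert (0 <= h / (1 + h) <= 1).
  { split; [left; apply Rdiv_lt_0_compat; lra|].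
    apply Rmult_le_reg_r with (1 + h); [lra|]. field_simplify; lra. }
  specialize (H H0).
  apply Rmult_le_compat_r with (r := 1 + h) in H; [|lra].
  replace (((1 - h / (1 + h)) * ln (Gamma (y + h)) + h / (1 + h) * ln (Gamma (y - 1))) * (1 + h))
    with (ln (Gamma (y + h)) + h * ln (Gamma (y - 1))) in H by (field; lra).
  nra.
- assert (H := Gamma_log_convex y (y + 1) h ltac:(lra) ltac:(lra) ltac:(lra)).
  replace ((1 - h) * y + h * (y + 1)) with (y + h) in H by ring.
  nra.
Qed.

Lemma ln_Gamma_decr_bounds (y h : R) (hy : 1 < y) (hh : 0 < h < 1) :
  h * ln (y - 1) <= ln (Gamma y) - ln (Gamma (y - h)) <= h * ln y.
Proof.
assert (S0 := ln_Gamma_S y ltac:(lra)).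
assert (S1 := ln_Gamma_S (y - 1) ltac:(lra)).
replace (y - 1 + 1) with y in S1 by ring.
split.
- assert (H := Gamma_log_convex y (y - 1) h ltac:(lra) ltac:(lra) ltac:(lra)).
  replace ((1 - h) * y + h * (y - 1)) with (y - h) in H by ring.
  nra.
- assert (H := Gamma_log_convex (y - h) (y + 1) (h / (1 + h)) ltac:(lra) ltac:(lra)).
  replace ((1 - h / (1 + h)) * (y - h) + h / (1 + h) * (y + 1)) with y in H by (field; lra).
  assert (0 <= h / (1 + h) <= 1).
  { split; [left; apply Rdiv_lt_0_compat; lra|].
    apply Rmult_le_reg_r with (1 + h); [lra|]. field_simplify; lra. }
  specialize (H H0).
  apply Rmult_le_compat_r with (r := 1 + h) in H; [|lra].
  replace (((1 - h / (1 + h)) * ln (Gamma (y - h)) + h / (1 + h) * ln (Gamma (y + 1))) * (1 + h))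
    with (ln (Gamma (y - h)) + h * ln (Gamma (y + 1))) in H by (field; lra).
  nra.
Qed.

Lemma ln_Gamma_quotient_bounds (y h : R) (hy : 1 < y) (hh : -1 < h < 1) (h0 : h <> 0) :
  ln (y - 1) <= (ln (Gamma (y + h)) - ln (Gamma y)) / h <= ln y.
Proof.
set (q := (ln (Gamma (y + h)) - ln (Gamma y)) / h).
assert (hq : q * h = ln (Gamma (y + h)) - ln (Gamma y)) by (unfold q; field; assumption).
destruct (Rlt_le_dec 0 h) as [hp|hn].
- destruct (ln_Gamma_incr_bounds y h hy ltac:(lra)) as [H1 H2].
  split; apply Rmult_le_reg_r with h; lra.
- destruct (ln_Gamma_decr_bounds y (- h) hy ltac:(lra)) as [H1 H2].
  replace (y - - h) with (y + h) in H1, H2 by ring.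
  split; apply Rmult_le_reg_r with (- h); lra.
Qed.

Lemma is_derive_shift_sum (f f' : R -> R) (x : R) (n : nat)
  (hf : forall y, 0 < y -> is_derive f y (f' y)) (hx : 0 < x) :
  is_derive (fun y => shift_sum f y n) x (shift_sum f' x n).
Proof.
induction n as [|n IH]; simpl.
- apply (is_derive_const (V := R_NormedModule) 0).
- apply (is_derive_plus (fun y => shift_sum f y n)); auto.
  assert (H := pos_INR n).
  replace (f' (x + INR n)) with (scal 1 (f' (x + INR n)))
    by (unfold scal; simpl; unfold mult; simpl; ring).
  apply (is_derive_comp f (fun y => y + INR n)).
  + apply hf; lra.
  + auto_derive; trivial; ring.
Qed.

Definition psi_approx (x : R) (n : nat) : R := ln (x + INR n) - shift_sum Rinv x n.

Lemma ln_step (y : R) (hy : 0 < y) : / (y + 1) <= ln (y + 1) - ln y <= / y.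
Proof.
rewrite <- ln_div by lra.
split.
- assert (H := ln_ge_1_sub_inv ((y + 1) / y) ltac:(apply Rdiv_lt_0_compat; lra)).
  replace (1 - / ((y + 1) / y)) with (/ (y + 1)) in H by (field; lra); exact H.
- assert (H := ln_le_sub_1 ((y + 1) / y) ltac:(apply Rdiv_lt_0_compat; lra)).
  replace ((y + 1) / y - 1) with (/ y) in H by (field; lra); exact H.
Qed.

Lemma is_lim_seq_inv_shift (x : R) : is_lim_seq (fun n => / (x + INR n)) 0.
Proof.
replace (Finite 0) with (Rbar_inv p_infty) by reflexivity.
apply is_lim_seq_inv; [|discriminate].
eapply is_lim_seq_plus; [apply is_lim_seq_const|apply is_lim_seq_INR|reflexivity].
Qed.

(* [lnGamma] is convex, and at [x + n + 1] all its difference quotients of step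
   less than 1 lie between [ln (x + n)] and [ln (x + n + 1)]; the recurrence
   transports this back to [x]. *)
Lemma is_derive_ln_Gamma (x : R) (hx : 0 < x) :
  exists l : R, is_derive (fun y => ln (Gamma y)) x l /\ is_lim_seq (psi_approx x) l.
Proof.
set (lo := fun n => ln (x + INR n) - shift_sum Rinv x (S n)).
set (up := fun n => psi_approx x (S n)).
assert (Hgap : forall n, 0 <= up n - lo n <= / (x + INR n)).
{ intros n; assert (Hn := pos_INR n); unfold up, lo, psi_approx.
  rewrite S_INR.
  assert (H := ln_step (x + INR n) ltac:(lra)).
  assert (0 < / (x + INR n + 1)) by (apply Rinv_0_lt_compat; lra).
  replace (x + (INR n + 1)) with (x + INR n + 1) by ring; split; lra. }
assert (Hg0 : is_lim_seq (fun n => up n - lo n) 0).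
{ apply is_lim_seq_le_le with (u := fun _ => 0) (w := fun n => / (x + INR n)).
  - exact Hgap.
  - apply is_lim_seq_const.
  - apply is_lim_seq_inv_shift. }
assert (Hlo : forall n, lo n <= lo (S n)).
{ intros n; assert (Hn := pos_INR n); unfold lo; rewrite (shift_sum_S _ _ (S n)), S_INR; assert (H := ln_step (x + INR n) ltac:(lra)).
  replace (x + (INR n + 1)) with (x + INR n + 1) by ring; lra. }
assert (Hup : forall n, up (S n) <= up n).
{ intros n; assert (Hn := pos_INR n); unfold up, psi_approx; rewrite (shift_sum_S _ _ (S n)).
  rewrite (S_INR (S n)), (S_INR n).
  assert (H := ln_step (x + (INR n + 1)) ltac:(lra)).
  replace (x + (INR n + 1 + 1)) with (x + (INR n + 1) + 1) by ring; lra. }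
destruct (ex_lim_seq_adj lo up Hlo Hup Hg0) as ([l Hl] & [l' Hl'] & Heq).
rewrite (is_lim_seq_unique _ _ Hl), (is_lim_seq_unique _ _ Hl') in Heq.
injection Heq as Heq; subst l'.
exists l; split.
2:{ apply is_lim_seq_incr_1; exact Hl'. }
apply is_derive_Reals; intros eps Heps.
(* Half of [eps] goes to the gap [up N - lo N], which confines the difference quotient at
   [x + N + 1]; the other half goes to the quotient of the finite sum of logarithms that leads back
   to [x]. *)
destruct (proj2 (is_lim_seq_spec _ _) (is_lim_seq_inv_shift x) (mkposreal (eps / 2) ltac:(lra))) as [N HN].
specialize (HN N (Nat.le_refl N)); simpl in HN.
assert (Hn := pos_INR N).
rewrite Rminus_0_r, Rabs_pos_eq in HN by (left; apply Rinv_0_lt_compat; lra).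
assert (HD : derivable_pt_lim (fun y => shift_sum ln y (S N)) x (shift_sum Rinv x (S N))).
{ apply is_derive_Reals, is_derive_shift_sum; [|assumption].
  intros y Hy; apply is_derive_Reals, derivable_pt_lim_ln; assumption. }
destruct (HD (eps / 2) ltac:(lra)) as [d Hd].
assert (Hm : 0 < Rmin d (Rmin 1 x)).
{ apply Rmin_glb_lt; [apply cond_pos | apply Rmin_glb_lt; lra]. }
exists (mkposreal _ Hm); simpl; intros h h0 Hh.
assert (Hh1 : Rabs h < d) by (eapply Rlt_le_trans; [exact Hh|apply Rmin_l]).
assert (Hh2 : Rabs h < Rmin 1 x) by (eapply Rlt_le_trans; [exact Hh|apply Rmin_r]).
assert (Hh3 : Rabs h < 1) by (eapply Rlt_le_trans; [exact Hh2|apply Rmin_l]).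
assert (Hh4 : Rabs h < x) by (eapply Rlt_le_trans; [exact Hh2|apply Rmin_r]).
apply Rabs_def2 in Hh3; apply Rabs_def2 in Hh4.
specialize (Hd h h0 Hh1); apply Rabs_def2 in Hd.
assert (Hq := ln_Gamma_quotient_bounds (x + INR (S N)) h).
rewrite S_INR in Hq; specialize (Hq ltac:(lra) ltac:(lra) h0).
replace (x + (INR N + 1) - 1) with (x + INR N) in Hq by ring.
replace (x + (INR N + 1) + h) with (x + h + (INR N + 1)) in Hq by ring.
rewrite <- S_INR, !ln_Gamma_shift in Hq by lra.
assert (Hlol := is_lim_seq_incr_compare lo l Hl Hlo N).
assert (Hupl := is_lim_seq_decr_compare up l Hl' Hup N).
specialize (Hgap N).
unfold up, psi_approx, lo in *.
set (A := shift_sum ln (x + h) (S N)) in *.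
set (B := shift_sum ln x (S N)) in *.
set (D := shift_sum Rinv x (S N)) in *.
replace ((ln (Gamma (x + h)) + A - (ln (Gamma x) + B)) / h)
  with ((ln (Gamma (x + h)) - ln (Gamma x)) / h + (A - B) / h) in Hq by (field; assumption).
apply Rabs_def1; lra.
Qed.

(** [Derive] is total, so its value is meaningful only once [Gamma] is known to be differentiable.
    This is inherited from [ln Gamma], as [Gamma = exp (ln Gamma)] near [x]. *)
Lemma is_lim_seq_digamma (x : R) (hx : 0 < x) : is_lim_seq (psi_approx x) (digamma x).
Proof.
destruct (is_derive_ln_Gamma x hx) as (l & Hd & Hl).
replace (digamma x) with l; [exact Hl|].
assert (HG : is_derive Gamma x (l * Gamma x)).
{ apply is_derive_ext_loc with (fun y => exp (ln (Gamma y))).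
  - exists (mkposreal x hx); intros y Hy; apply Rabs_lt_between' in Hy; simpl in Hy.
    apply exp_ln, Gamma_pos; lra.
  - replace (l * Gamma x) with (scal l (exp (ln (Gamma x)))).
    + apply (is_derive_comp exp (fun y => ln (Gamma y))); auto.
      apply is_derive_exp.
    + rewrite exp_ln by (apply Gamma_pos; assumption); reflexivity. }
assert (HP := Gamma_pos x hx).
assert (E : Derive Gamma x = l * Gamma x) by (apply is_derive_unique; exact HG).
unfold digamma; rewrite E; field; lra.
Qed.

(** * Coefficients and the constant [Rhat] *)

Definition hcoef (a b : R) (n : nat) : R :=
  poch a n * poch b n / poch (a + b) n / INR (Factorial.fact n).

Definition vcoef (a b : R) (n : nat) : R := INR n * hcoef a b n.

(** These numbers have two roles: they are the increments of [vcoef] and the Taylor coefficients of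
    [T = (1 - x) F']. So the value of [T] at 1 is the limit of [vcoef]. *)
Definition dcoef (a b : R) (n : nat) : R := a * b * hcoef a b n / (a + b + INR n).

Lemma poch_pos (a : R) (n : nat) (ha : 0 < a) : 0 < poch a n.
Proof.
induction n as [|n IH]; simpl; [lra|].
assert (H := pos_INR n); apply Rmult_lt_0_compat; lra.
Qed.

Lemma hcoef_0 (a b : R) : hcoef a b 0 = 1.
Proof. unfold hcoef; simpl; field. Qed.

Lemma hcoef_S (a b : R) (n : nat) (ha : 0 < a) (hb : 0 < b) :
  hcoef a b (S n) =
  hcoef a b n * ((a + INR n) * (b + INR n) / ((a + b + INR n) * (INR n + 1))).
Proof.
unfold hcoef; rewrite fact_simpl, mult_INR, S_INR; simpl poch.
assert (H := pos_INR n); assert (Hp := poch_pos (a + b) n ltac:(lra)).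
assert (Hf := INR_fact_neq_0 n).
field; repeat split; lra.
Qed.

Lemma hcoef_pos (a b : R) (n : nat) (ha : 0 < a) (hb : 0 < b) : 0 < hcoef a b n.
Proof.
unfold hcoef; repeat apply Rdiv_lt_0_compat; try apply Rmult_lt_0_compat;
  try apply poch_pos; try apply INR_fact_lt_0; lra.
Qed.

Lemma hcoef_sym (a b : R) (n : nat) : hcoef a b n = hcoef b a n.
Proof. unfold hcoef; rewrite (Rplus_comm b a), (Rmult_comm (poch b n)); reflexivity. Qed.

Lemma dcoef_pos (a b : R) (n : nat) (ha : 0 < a) (hb : 0 < b) : 0 < dcoef a b n.
Proof.
assert (H := pos_INR n); apply Rdiv_lt_0_compat; [|lra].
apply Rmult_lt_0_compat; [apply Rmult_lt_0_compat | apply hcoef_pos]; assumption.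
Qed.

Lemma vcoef_S (a b : R) (n : nat) (ha : 0 < a) (hb : 0 < b) :
  vcoef a b (S n) = vcoef a b n + dcoef a b n.
Proof.
unfold vcoef, dcoef; rewrite hcoef_S, S_INR by assumption.
assert (H := pos_INR n); field; lra.
Qed.

Lemma vcoef_S_ratio (a b : R) (n : nat) (ha : 0 < a) (hb : 0 < b) :
  vcoef a b (S (S n)) =
  vcoef a b (S n) * (1 + a * b / (INR (S n) * (a + b + INR (S n)))).
Proof.
rewrite vcoef_S by assumption; unfold vcoef, dcoef.
assert (H := pos_INR n); rewrite S_INR; field; lra.
Qed.

Lemma vcoef_S_pos (a b : R) (n : nat) (ha : 0 < a) (hb : 0 < b) : 0 < vcoef a b (S n).
Proof.
apply Rmult_lt_0_compat; [apply lt_0_INR; lia | apply hcoef_pos; assumption].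
Qed.

Lemma vcoef_incr (a b : R) (n : nat) (ha : 0 < a) (hb : 0 < b) :
  vcoef a b n <= vcoef a b (S n).
Proof. rewrite vcoef_S by assumption; assert (H := dcoef_pos a b n ha hb); lra. Qed.

(** A decreasing companion of the increasing [vcoef]. The growth factor [1 + a b / (n (a + b + n))]
    is at most the exponential of [2 a b / (n (n + 1))]; the factor 2 comes from [n + 1 <= 2 n], and
    this exponent telescopes. *)
Lemma vcoef_upper (a b : R) (n k : nat) (ha : 0 < a) (hb : 0 < b) :
  vcoef a b (S (n + k)) * exp (2 * (a * b) / INR (S (n + k))) <=
  vcoef a b (S n) * exp (2 * (a * b) / INR (S n)).
Proof.
induction k as [|k IH]; [rewrite Nat.add_0_r; lra|].
eapply Rle_trans; [|exact IH].
rewrite Nat.add_succ_r, vcoef_S_ratio, Rmult_assoc by assumption.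
apply Rmult_le_compat_l; [left; apply vcoef_S_pos; assumption|].
set (m := (n + k)%nat); set (e := a * b / (INR (S m) * (a + b + INR (S m)))).
assert (Hm := pos_INR m).
assert (He := exp_ge_tangent 0 e); rewrite exp_0 in He.
apply Rle_trans with (exp e * exp (2 * (a * b) / INR (S (S m)))).
{ apply Rmult_le_compat_r; [left; apply exp_pos|lra]. }
rewrite <- exp_plus.
assert (Hab : 0 < a * b) by (apply Rmult_lt_0_compat; assumption).
assert (e <= 2 * (a * b) / INR (S m) - 2 * (a * b) / INR (S (S m))).
{ unfold e; rewrite !S_INR.
  replace (2 * (a * b) / (INR m + 1) - 2 * (a * b) / (INR m + 1 + 1))
    with (a * b / ((INR m + 1) * ((INR m + 1 + 1) / 2))) by (field; lra).
  apply Rmult_le_compat_l; [lra|]; apply Rinv_le_contravar.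
  - apply Rmult_lt_0_compat; lra.
  - apply Rmult_le_compat_l; lra. }
destruct (Rle_lt_or_eq_dec (e + 2 * (a * b) / INR (S (S m))) (2 * (a * b) / INR (S m)) ltac:(lra)) as [h|h].
- left; apply exp_increasing; exact h.
- right; rewrite h; reflexivity.
Qed.

(** The constant [C] of the overview; classically [Gamma (a + b) / (Gamma a * Gamma b)]. The proof
    works with the limit itself. *)
Definition hlim (a b : R) : R := real (Lim_seq (vcoef a b)).

Lemma vcoef_upper_lim (a b : R) (n k : nat) (ha : 0 < a) (hb : 0 < b) :
  vcoef a b (S (n + k)) <= vcoef a b (S n) * exp (2 * (a * b) / INR (S n)).
Proof.
eapply Rle_trans; [|apply (vcoef_upper a b n k ha hb)].
rewrite <- (Rmult_1_r (vcoef a b (S (n + k)))) at 1.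
apply Rmult_le_compat_l; [left; apply vcoef_S_pos; assumption|].
rewrite <- exp_0; left; apply exp_increasing, Rdiv_lt_0_compat.
- apply Rmult_lt_0_compat; [lra | apply Rmult_lt_0_compat; assumption].
- apply lt_0_INR; lia.
Qed.

Lemma is_lim_seq_vcoef (a b : R) (ha : 0 < a) (hb : 0 < b) :
  is_lim_seq (vcoef a b) (hlim a b).
Proof.
apply Lim_seq_correct', (ex_finite_lim_seq_incr _ (vcoef a b 1 * exp (2 * (a * b) / INR 1))).
- intros; apply vcoef_incr; assumption.
- intros n; eapply Rle_trans; [apply vcoef_incr; assumption|].
  apply (vcoef_upper_lim a b 0 n ha hb).
Qed.

Lemma vcoef_le_hlim (a b : R) (n : nat) (ha : 0 < a) (hb : 0 < b) : vcoef a b n <= hlim a b.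
Proof.
apply (is_lim_seq_incr_compare _ _ (is_lim_seq_vcoef a b ha hb)).
intros; apply vcoef_incr; assumption.
Qed.

Lemma hlim_pos (a b : R) (ha : 0 < a) (hb : 0 < b) : 0 < hlim a b.
Proof.
eapply Rlt_le_trans; [apply (vcoef_S_pos a b 0 ha hb) | apply vcoef_le_hlim; assumption].
Qed.

(** The rate [1 / n] makes the terms of [scoef] of order [1 / n^2], hence summable. *)
Lemma vcoef_defect (a b : R) (n : nat) (ha : 0 < a) (hb : 0 < b) :
  0 <= 1 - vcoef a b (S n) / hlim a b <= 2 * (a * b) / INR (S n).
Proof.
assert (HC := hlim_pos a b ha hb); assert (Hv := vcoef_le_hlim a b (S n) ha hb).
assert (Hi : 0 < / hlim a b) by (apply Rinv_0_lt_compat; assumption).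
set (e := 2 * (a * b) / INR (S n)).
assert (H : hlim a b <= vcoef a b (S n) * exp e).
{ change (Rbar_le (hlim a b) (vcoef a b (S n) * exp e)).
  apply is_lim_seq_le with (fun k => vcoef a b (k + S n)) (fun _ => vcoef a b (S n) * exp e).
  - intros k; rewrite Nat.add_succ_r, Nat.add_comm; apply vcoef_upper_lim; assumption.
  - apply -> is_lim_seq_incr_n; apply is_lim_seq_vcoef; assumption.
  - apply is_lim_seq_const. }
assert (He := exp_ge_tangent 0 (- e)); rewrite exp_0 in He.
assert (H' : hlim a b * exp (- e) <= vcoef a b (S n)).
{ apply Rmult_le_compat_r with (r := exp (- e)) in H; [|left; apply exp_pos].
  rewrite Rmult_assoc, <- exp_plus, Rplus_opp_r, exp_0 in H; lra. }
assert (E : hlim a b * / hlim a b = 1) by (apply Rinv_r; lra).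
split; unfold Rdiv.
- apply Rmult_le_compat_r with (r := / hlim a b) in Hv; lra.
- assert (hlim a b * (1 - e) <= vcoef a b (S n)) by nra.
  apply Rmult_le_compat_r with (r := / hlim a b) in H0; nra.
Qed.

(** The growth factor [1 + a b / (n (a + b + n))] increases with [a] and [b]. The inequality is
    cross-multiplied so that it passes to the limit in [k], and it starts at [S n] because [vcoef]
    vanishes at 0. *)
Lemma vcoef_cross (a b a' b' : R) (n k : nat) (ha : 0 < a) (hb : 0 < b)
  (haa : a <= a') (hbb : b <= b') :
  vcoef a' b' (S n) * vcoef a b (k + S n) <= vcoef a b (S n) * vcoef a' b' (k + S n).
Proof.
induction k as [|k IH]; [simpl; lra|].
replace (S k + S n)%nat with (S (S (k + n))) by lia.
rewrite Nat.add_succ_r in IH.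
rewrite !vcoef_S_ratio, <- !Rmult_assoc by lra.
set (m := (k + n)%nat) in *.
assert (Hm : 0 < INR (S m)) by (apply lt_0_INR; lia).
apply Rmult_le_compat; auto.
- left; apply Rmult_lt_0_compat; apply vcoef_S_pos; lra.
- assert (0 < a * b / (INR (S m) * (a + b + INR (S m)))); [|lra].
  apply Rdiv_lt_0_compat; apply Rmult_lt_0_compat; lra.
- apply Rplus_le_compat_l.
  assert (0 <= a' * b' / (INR (S m) * (a' + b' + INR (S m))) - a * b / (INR (S m) * (a + b + INR (S m)))); [|lra].
  replace (a' * b' / (INR (S m) * (a' + b' + INR (S m))) - a * b / (INR (S m) * (a + b + INR (S m))))
    with ((a * a' * (b' - b) + b * b' * (a' - a) + INR (S m) * (a' * b' - a * b)) /
      (INR (S m) * (a' + b' + INR (S m)) * (a + b + INR (S m)))) by (field; lra).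
  apply Rmult_le_pos.
  + assert (a * b <= a' * b') by (apply Rmult_le_compat; lra).
    repeat apply Rplus_le_le_0_compat; repeat apply Rmult_le_pos; lra.
  + left; apply Rinv_0_lt_compat; repeat apply Rmult_lt_0_compat; lra.
Qed.

Lemma vcoef_hlim_antitone (a b a' b' : R) (n : nat) (ha : 0 < a) (hb : 0 < b)
  (haa : a <= a') (hbb : b <= b') :
  vcoef a' b' (S n) / hlim a' b' <= vcoef a b (S n) / hlim a b.
Proof.
assert (HC := hlim_pos a b ha hb).
assert (HC' := hlim_pos a' b' ltac:(lra) ltac:(lra)).
assert (H : vcoef a' b' (S n) * hlim a b <= vcoef a b (S n) * hlim a' b').
{ change (Rbar_le (vcoef a' b' (S n) * hlim a b) (vcoef a b (S n) * hlim a' b')).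
  apply is_lim_seq_le with (fun k => vcoef a' b' (S n) * vcoef a b (k + S n))
    (fun k => vcoef a b (S n) * vcoef a' b' (k + S n)).
  - intros k; apply vcoef_cross; assumption.
  - apply (is_lim_seq_scal_l _ _ (Finite _)); apply -> is_lim_seq_incr_n;
      apply is_lim_seq_vcoef; assumption.
  - apply (is_lim_seq_scal_l _ _ (Finite _)); apply -> is_lim_seq_incr_n;
      apply is_lim_seq_vcoef; lra. }
apply Rmult_le_reg_r with (hlim a b * hlim a' b'); [apply Rmult_lt_0_compat; assumption|].
field_simplify; lra.
Qed.

Lemma vcoef_monotone (a b a' b' : R) (ha : 0 < a) (hb : 0 < b)
  (haa : a <= a') (hbb : b <= b') (n : nat) : vcoef a b (S n) <= vcoef a' b' (S n).
Proof.
assert (H1 : vcoef a b 1 <= vcoef a' b' 1).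
{ unfold vcoef; rewrite !hcoef_S, !hcoef_0 by lra; simpl INR.
  rewrite !Rplus_0_r, !Rplus_0_l, !Rmult_1_l, !Rmult_1_r.
  apply Rmult_le_reg_r with ((a + b) * (a' + b')); [apply Rmult_lt_0_compat; lra|].
  replace (a * b / (a + b) * ((a + b) * (a' + b'))) with (a * b * (a' + b')) by (field; lra).
  replace (a' * b' / (a' + b') * ((a + b) * (a' + b'))) with (a' * b' * (a + b)) by (field; lra).
  assert (a * (b * a') <= a * (b' * a')) by (repeat apply Rmult_le_compat_l; try lra; apply Rmult_le_compat_r; lra).
  assert (b * b' * a <= b * b' * a') by (apply Rmult_le_compat_l; [apply Rmult_le_pos|]; lra).
  lra. }
assert (H := vcoef_cross a b a' b' 0 n ha hb haa hbb).
rewrite Nat.add_1_r in H.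
assert (P := vcoef_S_pos a b 0 ha hb); assert (P' := vcoef_S_pos a' b' n ltac:(lra) ltac:(lra)).
assert (P1 := vcoef_S_pos a b n ha hb).
nra.
Qed.

Lemma hlim_monotone (a b a' b' : R) (ha : 0 < a) (hb : 0 < b)
  (haa : a <= a') (hbb : b <= b') : hlim a b <= hlim a' b'.
Proof.
change (Rbar_le (hlim a b) (hlim a' b')).
apply is_lim_seq_le with (fun n => vcoef a b (S n)) (fun n => vcoef a' b' (S n)).
- intros; apply vcoef_monotone; assumption.
- apply -> is_lim_seq_incr_1; apply is_lim_seq_vcoef; assumption.
- apply -> is_lim_seq_incr_1; apply is_lim_seq_vcoef; lra.
Qed.

Lemma hcoef_shift (a b : R) (n : nat) (ha : 0 < a) (hb : 0 < b) :
  hcoef (a + 1) b n = hcoef a b n * ((a + INR n) * (a + b) / (a * (a + b + INR n))).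
Proof.
induction n as [|n IH].
- rewrite !hcoef_0; simpl; field; lra.
- rewrite !hcoef_S, IH, S_INR by lra; assert (H := pos_INR n); field; lra.
Qed.

Lemma hlim_shift (a b : R) (ha : 0 < a) (hb : 0 < b) :
  hlim (a + 1) b = hlim a b * ((a + b) / a).
Proof.
apply Rbar_finite_eq.
rewrite <- (is_lim_seq_unique _ _ (is_lim_seq_vcoef (a + 1) b ltac:(lra) hb)).
apply is_lim_seq_unique.
apply is_lim_seq_ext with (fun n => vcoef a b n * ((a + b) / a * (1 - b * / (a + b + INR n)))).
{ intros n; unfold vcoef; rewrite hcoef_shift by assumption.
  assert (H := pos_INR n); field; lra. }
replace (hlim a b * ((a + b) / a)) with (hlim a b * ((a + b) / a * (1 - b * 0))) by ring.
apply is_lim_seq_mult'; [apply is_lim_seq_vcoef; assumption|].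
apply is_lim_seq_mult'; [apply is_lim_seq_const|].
apply is_lim_seq_minus'; [apply is_lim_seq_const|].
apply is_lim_seq_mult'; [apply is_lim_seq_const|apply is_lim_seq_inv_shift].
Qed.

Lemma is_series_dcoef (a b : R) (ha : 0 < a) (hb : 0 < b) : is_series (dcoef a b) (hlim a b).
Proof.
change (is_lim_seq (sum_n (dcoef a b)) (hlim a b)).
apply is_lim_seq_ext with (fun n => vcoef a b (S n)).
- intros n; induction n as [|n IH].
  + rewrite sum_O, vcoef_S by assumption; unfold vcoef; simpl; ring.
  + rewrite sum_Sn, <- IH, vcoef_S by assumption; reflexivity.
- apply -> is_lim_seq_incr_1; apply is_lim_seq_vcoef; assumption.
Qed.

(** * Series bounds and Abel summation with a rate *)

Lemma inv_sq_sum (n : nat) : sum_n (fun k => / INR (S k) ^ 2) n <= 2 - / INR (S n).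
Proof.
induction n as [|n IH].
- rewrite sum_O; simpl; lra.
- rewrite sum_Sn; unfold plus; simpl plus; eapply Rle_trans; [apply Rplus_le_compat_r, IH|].
  rewrite !S_INR; assert (H := pos_INR n).
  set (m := INR n) in *.
  assert (0 <= / (m + 1) - / (m + 1 + 1) - / (m + 1 + 1) ^ 2); [|simpl in *; lra].
  replace (/ (m + 1) - / (m + 1 + 1) - / (m + 1 + 1) ^ 2)
    with (/ ((m + 1) * (m + 1 + 1) ^ 2)) by (field; lra).
  left; apply Rinv_0_lt_compat, Rmult_lt_0_compat; [lra|apply pow_lt; lra].
Qed.

(** The exponent 3/2 is what remains of [1 / n^2] after the weight [sqrt n] from [one_sub_pow_le].
    Each new term is at most [2 / sqrt n - 2 / sqrt (n + 1)], with the term taken at [n + 1]. *)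
Lemma inv_pow_3_2_sum (n : nat) :
  sum_n (fun k => / (INR (S k) * sqrt (INR (S k)))) n <= 3 - 2 / sqrt (INR (S n)).
Proof.
induction n as [|n IH].
- rewrite sum_O; simpl; rewrite sqrt_1; lra.
- rewrite sum_Sn; unfold plus; simpl plus; eapply Rle_trans; [apply Rplus_le_compat_r, IH|].
  set (x := sqrt (INR (S n))); set (y := sqrt (INR (S (S n)))).
  assert (Hx : 0 < x) by (apply sqrt_lt_R0, lt_0_INR; lia).
  assert (Ex : x * x = INR (S n)) by (apply sqrt_sqrt, pos_INR).
  assert (Ey : y * y = INR (S (S n))) by (apply sqrt_sqrt, pos_INR).
  assert (Hxy : x < y) by (apply sqrt_lt_1; try apply pos_INR; apply lt_INR; lia).
  rewrite <- Ey; rewrite (S_INR (S n)) in Ey.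
  assert (E : (y - x) * (y + x) = 1) by lra.
  assert (0 <= 2 / x - 2 / y - / (y * y * y)); [|lra].
  replace (2 / x - 2 / y - / (y * y * y))
    with ((2 * (y - x) * (y * y) - x) / (x * y * y * y)) by (field; lra).
  apply Rmult_le_pos; [|left; apply Rinv_0_lt_compat; repeat apply Rmult_lt_0_compat; lra].
  apply Rmult_le_reg_r with (y + x); [lra|].
  replace ((2 * (y - x) * (y * y) - x) * (y + x))
    with (2 * ((y - x) * (y + x)) * (y * y) - x * (y + x)) by ring.
  rewrite E; nra.
Qed.

Lemma ex_series_pos_bounded (s : nat -> R) (M : R) (hs : forall n, 0 <= s n)
  (hM : forall n, sum_n s n <= M) : ex_series s /\ Series s <= M.
Proof.
assert (Hinc : forall n, sum_n s n <= sum_n s (S n)).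
{ intros n; rewrite sum_Sn; unfold plus; simpl; assert (H := hs (S n)); lra. }
destruct (ex_finite_lim_seq_incr (sum_n s) M Hinc hM) as [l Hl].
assert (Hs : is_series s l) by exact Hl.
split; [exists l; exact Hs|].
rewrite (is_series_unique _ _ Hs).
change (Rbar_le l M); apply is_lim_seq_le with (sum_n s) (fun _ => M); auto.
apply is_lim_seq_const.
Qed.

Lemma ex_series_inv_sq_bound (s : nat -> R) (M : R)
  (hs : forall n, Rabs (s n) <= M / INR (S n) ^ 2) :
  ex_series (fun n => Rabs (s n)).
Proof.
apply (@ex_series_le R_AbsRing R_CompleteNormedModule (fun n => Rabs (s n)) (fun n => M * / INR (S n) ^ 2)).
- intros n; unfold norm; simpl; unfold abs; simpl; rewrite Rabs_Rabsolu; apply hs.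
- apply (@ex_series_scal_l R_AbsRing R_NormedModule M (fun n => / INR (S n) ^ 2)), (ex_series_pos_bounded _ 2).
  + intros n; left; apply Rinv_0_lt_compat, pow_lt, lt_0_INR; lia.
  + intros n; eapply Rle_trans; [apply inv_sq_sum|].
    assert (0 < / INR (S n)) by (apply Rinv_0_lt_compat, lt_0_INR; lia); lra.
Qed.

(** As [1 - x^n] lies in [[0, 1]], its square is at most itself, hence at most [n (1 - x)]. The
    square root gives up decay in [1 - x] for slower growth in [n]: the linear bound against terms
    of size [1 / n^2] would leave a divergent harmonic sum. *)
Lemma one_sub_pow_le (x : R) (n : nat) (hx : 0 <= x <= 1) :
  0 <= 1 - x ^ n <= sqrt (INR n * (1 - x)).
Proof.
assert (H0 : 0 <= x ^ n <= 1).
{ split; [apply pow_le; lra|]; rewrite <- (pow1 n); apply pow_incr; lra. }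
assert (H1 : 1 - x ^ n <= INR n * (1 - x)).
{ clear H0; induction n as [|n IH]; [simpl; lra|].
  rewrite S_INR; simpl.
  assert (0 <= x ^ n <= 1).
  { split; [apply pow_le; lra|]; rewrite <- (pow1 n); apply pow_incr; lra. }
  nra. }
split; [lra|].
rewrite <- (sqrt_square (1 - x ^ n)) by lra.
apply sqrt_le_1; [apply Rmult_le_pos; lra | apply Rmult_le_pos; [apply pos_INR|lra] | nra].
Qed.

(* Abel's theorem with a rate, from [1 - x^n <= sqrt (n (1 - x))]. *)
Lemma Abel_rate (s y : nat -> R) (x M : R) (hx : 0 <= x <= 1)
  (hs : forall n, Rabs (s n) <= M / INR (S n) ^ 2)
  (hy : forall n, 0 <= 1 - y n <= 1 - x ^ S n) :
  Rabs (Series s - Series (fun n => s n * y n)) <= 3 * M * sqrt (1 - x).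
Proof.
assert (Ha := ex_series_inv_sq_bound s M hs).
assert (Hy : forall n, 0 <= y n <= 1).
{ intros n; specialize (hy n); assert (0 <= x ^ S n) by (apply pow_le; lra); lra. }
assert (Hb : ex_series (fun n => Rabs (s n * y n))).
{ apply (ex_series_inv_sq_bound _ M); intros n; eapply Rle_trans; [|apply hs].
  rewrite Rabs_mult, (Rabs_pos_eq (y n)) by apply Hy.
  assert (H := Rabs_pos (s n)); specialize (Hy n); nra. }
rewrite <- Series_minus by (apply ex_series_Rabs; assumption).
assert (HM : 0 <= M).
{ specialize (hs 0%nat); simpl in hs; assert (H := Rabs_pos (s 0%nat)); lra. }
assert (Hsq := sqrt_pos (1 - x)).
assert (Hle : forall n, Rabs (s n - s n * y n) <=
   M * sqrt (1 - x) * / (INR (S n) * sqrt (INR (S n)))).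
{ intros n; replace (s n - s n * y n) with (s n * (1 - y n)) by ring.
  rewrite Rabs_mult, (Rabs_pos_eq (1 - y n)) by apply hy.
  assert (Hn : 0 < INR (S n)) by (apply lt_0_INR; lia).
  assert (Hp := one_sub_pow_le x (S n) hx); rewrite sqrt_mult in Hp by lra.
  assert (Hn2 : 0 < sqrt (INR (S n))) by (apply sqrt_lt_R0; assumption).
  replace (M * sqrt (1 - x) * / (INR (S n) * sqrt (INR (S n))))
    with (M / INR (S n) ^ 2 * (sqrt (INR (S n)) * sqrt (1 - x))).
  - apply Rmult_le_compat; auto using Rabs_pos; [apply hy|].
    specialize (hy n); lra.
  - assert (E := sqrt_sqrt (INR (S n)) ltac:(lra)).
    set (r := sqrt (INR (S n))) in *; rewrite <- E; field; lra. }
assert (HB : ex_series (fun n => / (INR (S n) * sqrt (INR (S n)))) /\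
   Series (fun n => / (INR (S n) * sqrt (INR (S n)))) <= 3).
{ apply ex_series_pos_bounded.
  - intros n; left; apply Rinv_0_lt_compat, Rmult_lt_0_compat; [|apply sqrt_lt_R0]; apply lt_0_INR; lia.
  - intros n; eapply Rle_trans; [apply inv_pow_3_2_sum|].
    assert (0 < 2 / sqrt (INR (S n))); [|lra].
    apply Rdiv_lt_0_compat; [lra|apply sqrt_lt_R0, lt_0_INR; lia]. }
destruct HB as [HB1 HB2].
assert (HB3 : ex_series (fun n => M * sqrt (1 - x) * / (INR (S n) * sqrt (INR (S n)))))
  by exact (@ex_series_scal_l R_AbsRing R_NormedModule (M * sqrt (1 - x)) _ HB1).
eapply Rle_trans; [apply Series_Rabs|].
{ apply (@ex_series_le R_AbsRing R_CompleteNormedModule (fun n => Rabs (s n - s n * y n)) _) in HB3; [exact HB3|].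
  intros n; unfold norm; simpl; unfold abs; simpl; rewrite Rabs_Rabsolu; apply Hle. }
eapply Rle_trans; [apply Series_le; [|exact HB3]|].
- intros n; split; [apply Rabs_pos|apply Hle].
- rewrite Series_scal_l.
  apply Rle_trans with (M * sqrt (1 - x) * 3); [|lra].
  apply Rmult_le_compat_l; [apply Rmult_le_pos|]; assumption.
Qed.

(** The coefficient of [x^(n+1)] in [F / C - L], whose constant term is [1 / C]; so [Rhat] is the
    value of that series at 1. Written through [vcoef], its sign and its size [1 / n^2] are
    visible. *)
Definition scoef (a b : R) (n : nat) : R := (vcoef a b (S n) / hlim a b - 1) / INR (S n).

Definition Rhat (a b : R) : R := / hlim a b + Series (scoef a b).

Lemma scoef_bound (a b : R) (n : nat) (ha : 0 < a) (hb : 0 < b) :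
  Rabs (scoef a b n) <= 2 * (a * b) / INR (S n) ^ 2.
Proof.
assert (H := vcoef_defect a b n ha hb).
assert (Hn : 0 < INR (S n)) by (apply lt_0_INR; lia).
unfold scoef; rewrite <- Rabs_Ropp.
replace (- ((vcoef a b (S n) / hlim a b - 1) / INR (S n)))
  with ((1 - vcoef a b (S n) / hlim a b) * / INR (S n)) by (assert (HC := hlim_pos a b ha hb); field; split; lra).
assert (Hi : 0 < / INR (S n)) by (apply Rinv_0_lt_compat; assumption).
rewrite Rabs_pos_eq by (apply Rmult_le_pos; lra).
replace (2 * (a * b) / INR (S n) ^ 2) with (2 * (a * b) / INR (S n) * / INR (S n)) by (field; lra).
apply Rmult_le_compat_r; lra.
Qed.

Lemma ex_series_scoef (a b : R) (ha : 0 < a) (hb : 0 < b) : ex_series (scoef a b).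
Proof.
apply ex_series_Rabs, (ex_series_inv_sq_bound _ (2 * (a * b))).
intros; apply scoef_bound; assumption.
Qed.

Lemma scoef_hcoef (a b : R) (n : nat) :
  scoef a b n = hcoef a b (S n) / hlim a b - / INR (S n).
Proof.
unfold scoef, vcoef, Rdiv; rewrite Rmult_minus_distr_r.
assert (INR (S n) * / INR (S n) = 1) by (apply Rinv_r, not_0_INR; lia).
replace (INR (S n) * hcoef a b (S n) * / hlim a b * / INR (S n))
  with (hcoef a b (S n) * / hlim a b * (INR (S n) * / INR (S n))) by ring.
rewrite H; ring.
Qed.

Lemma Rhat_sym (a b : R) : Rhat a b = Rhat b a.
Proof.
assert (E : hlim a b = hlim b a).
{ unfold hlim; f_equal; apply Lim_seq_ext; intros n; unfold vcoef; rewrite hcoef_sym; reflexivity. }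
unfold Rhat; rewrite E; f_equal; apply Series_ext; intros n.
unfold scoef, vcoef; rewrite hcoef_sym, E; reflexivity.
Qed.

Lemma Rhat_antitone (a b a' b' : R) (ha : 0 < a) (hb : 0 < b)
  (haa : a <= a') (hbb : b <= b') : Rhat a' b' <= Rhat a b.
Proof.
unfold Rhat; apply Rplus_le_compat.
- apply Rinv_le_contravar; [apply hlim_pos; assumption | apply hlim_monotone; assumption].
- assert (Hs := ex_series_scoef a b ha hb).
  assert (Hs' := ex_series_scoef a' b' ltac:(lra) ltac:(lra)).
  (* The terms of [scoef] are nonpositive, while [Series_le] compares nonnegative ones; hence the
     change of sign. *)
  assert (H : Series (fun n => - scoef a b n) <= Series (fun n => - scoef a' b' n)).
  { apply Series_le; [|exact (@ex_series_opp R_AbsRing R_NormedModule _ Hs')].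
    intros n; assert (Hn : 0 < / INR (S n)) by (apply Rinv_0_lt_compat, lt_0_INR; lia).
    assert (H1 := vcoef_defect a b n ha hb).
    assert (H2 := vcoef_hlim_antitone a b a' b' n ha hb haa hbb).
    unfold scoef, Rdiv at 1 3 5; split; nra. }
  rewrite !Series_opp in H; lra.
Qed.

Lemma Rhat_shift (a b : R) (ha : 0 < a) (hb : 0 < b) : Rhat (a + 1) b = Rhat a b - / a.
Proof.
assert (Hs := ex_series_scoef a b ha hb).
assert (Hs' := ex_series_scoef (a + 1) b ltac:(lra) hb).
assert (HC := hlim_pos a b ha hb).
(* Termwise the difference is a multiple of [dcoef], whose full sum is [C]. The missing term at
   index 0 contributes [b / ((a + b) C)], which is exactly [1 / hlim a b - 1 / hlim (a + 1) b]. *)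
assert (E : Series (fun n => scoef a b n - scoef (a + 1) b n) =
  Series (fun n => / (a * hlim a b) * dcoef a b (S n))).
{ apply Series_ext; intros n; rewrite !scoef_hcoef, hlim_shift, hcoef_shift by assumption.
  unfold dcoef; assert (H := pos_INR (S n)); assert (INR (S n) <> 0) by (apply not_0_INR; lia).
  field; repeat split; lra. }
rewrite Series_minus, Series_scal_l in E by assumption.
assert (Hd := is_series_dcoef a b ha hb).
assert (Hd1 := Series_incr_1 (dcoef a b) (ex_intro _ _ Hd)).
rewrite (is_series_unique _ _ Hd) in Hd1.
replace (Series (fun n => dcoef a b (S n))) with (hlim a b - dcoef a b 0) in E by lra.
unfold Rhat; rewrite hlim_shift by assumption.
replace (Series (scoef (a + 1) b)) with
 (Series (scoef a b) - / (a * hlim a b) * (hlim a b - dcoef a b 0)) by lra.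
unfold dcoef; rewrite hcoef_0; simpl; field; repeat split; lra.
Qed.

Lemma hcoef_1_1 (n : nat) : hcoef 1 1 n = / (INR n + 1).
Proof.
induction n as [|n IH]; [rewrite hcoef_0; simpl; field|].
rewrite hcoef_S, IH, S_INR by lra; assert (H := pos_INR n); field; lra.
Qed.

Lemma hlim_1_1 : hlim 1 1 = 1.
Proof.
apply Rbar_finite_eq.
rewrite <- (is_lim_seq_unique _ _ (is_lim_seq_vcoef 1 1 ltac:(lra) ltac:(lra))).
apply is_lim_seq_unique.
apply is_lim_seq_ext with (fun n => 1 - / (1 + INR n)).
{ intros n; unfold vcoef; rewrite hcoef_1_1; assert (H := pos_INR n); field; lra. }
replace (Finite 1) with (Finite (1 - 0)) by (f_equal; ring).
apply is_lim_seq_minus'; [apply is_lim_seq_const|apply is_lim_seq_inv_shift].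
Qed.

(** Here the terms of [scoef] are [1 / (n + 2) - 1 / (n + 1)]; they telescope to -1 and cancel
    [1 / hlim 1 1 = 1]. *)
Lemma Rhat_1_1 : Rhat 1 1 = 0.
Proof.
unfold Rhat; rewrite hlim_1_1.
assert (H : is_series (scoef 1 1) (0 - 1)).
{ change (is_lim_seq (sum_n (scoef 1 1)) (0 - 1)).
  apply is_lim_seq_ext with (fun n => / (2 + INR n) - 1).
  - intros n; induction n as [|n IH].
    + rewrite sum_O, scoef_hcoef, hcoef_1_1, hlim_1_1; simpl; field.
    + rewrite sum_Sn, <- IH, scoef_hcoef, hcoef_1_1, hlim_1_1, !S_INR; unfold plus; simpl.
      assert (H := pos_INR n); field; lra.
  - apply is_lim_seq_minus'; [apply is_lim_seq_inv_shift|apply is_lim_seq_const]. }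
rewrite (is_series_unique _ _ H); field.
Qed.

Lemma Rhat_shift_n (a b : R) (n : nat) (ha : 0 < a) (hb : 0 < b) :
  Rhat (a + INR n) (b + INR n) = Rhat a b - shift_sum Rinv a n - shift_sum Rinv b n.
Proof.
induction n as [|n IH]; [simpl; rewrite !Rplus_0_r; ring|].
assert (H := pos_INR n).
rewrite !shift_sum_S, S_INR, <- !Rplus_assoc, Rhat_shift by lra.
rewrite Rhat_sym, Rhat_shift, Rhat_sym, IH by lra; ring.
Qed.

Lemma is_lim_seq_ln_shift (x : R) (hx : 0 < x <= 1) :
  is_lim_seq (fun n => ln (1 + INR n) - ln (x + INR n)) 0.
Proof.
apply is_lim_seq_le_le with (u := fun _ => 0) (w := fun n => (1 - x) * / (x + INR n)).
- intros n; assert (H := pos_INR n).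
  rewrite <- ln_div by lra; split.
  + rewrite <- ln_1; apply ln_le; [lra|].
    apply Rmult_le_reg_r with (x + INR n); [lra|]; field_simplify; lra.
  + eapply Rle_trans; [apply ln_le_sub_1, Rdiv_lt_0_compat; lra|].
    right; field; lra.
- apply is_lim_seq_const.
- replace 0 with ((1 - x) * 0) by ring.
  apply (is_lim_seq_scal_l _ _ (Finite 0)), is_lim_seq_inv_shift.
Qed.

(* Bohr-Mollerup argument: both sides obey the same recurrence, and monotonicity
   of [Rhat] squeezes the values at [(a + n, b + n)] between those at
   [(n + 1, n + 1)] and [(n, n)], which differ by [2 / n]. *)
Lemma Rhat_ramanujan (a b : R) (ha : 0 < a <= 1) (hb : 0 < b <= 1) :
  Rhat a b = ramanujanR a b.
Proof.
(* In [2 psi(1) - psi(a) - psi(b)] the logarithms of the approximations cancel in the limit, so only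
   these sums of reciprocals survive. *)
set (g := fun n => shift_sum Rinv a n + shift_sum Rinv b n - 2 * shift_sum Rinv 1 n).
assert (H1 : is_lim_seq g (ramanujanR a b)).
{ unfold ramanujanR, euler_gamma.
  apply is_lim_seq_ext with (fun n => 2 * psi_approx 1 n - psi_approx a n - psi_approx b n
    - (ln (1 + INR n) - ln (a + INR n)) - (ln (1 + INR n) - ln (b + INR n))).
  { intros n; unfold psi_approx, g; ring. }
  replace (-2 * - digamma 1 - digamma a - digamma b)
    with (2 * digamma 1 - digamma a - digamma b - 0 - 0) by ring.
  repeat apply is_lim_seq_minus'; try apply is_lim_seq_digamma; try apply is_lim_seq_ln_shift; try lra.
  apply (is_lim_seq_scal_l _ 2 (Finite _)), is_lim_seq_digamma; lra. }
assert (H2 : is_lim_seq (fun n => Rhat a b - g (S n)) (Rhat a b - ramanujanR a b)).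
{ apply is_lim_seq_minus'; [apply is_lim_seq_const|].
  apply -> is_lim_seq_incr_1; exact H1. }
assert (H3 : is_lim_seq (fun n => Rhat a b - g (S n)) 0).
{ apply is_lim_seq_le_le with (u := fun _ => 0) (w := fun n => 2 * / (1 + INR n)).
  - intros n; assert (Hn := pos_INR n).
    assert (Eab := Rhat_shift_n a b (S n) ltac:(lra) ltac:(lra)).
    assert (E1 := Rhat_shift_n 1 1 (S n) ltac:(lra) ltac:(lra)).
    assert (E2 := Rhat_shift_n 1 1 n ltac:(lra) ltac:(lra)).
    rewrite Rhat_1_1 in E1, E2.
    assert (L := Rhat_antitone (a + INR (S n)) (b + INR (S n)) (1 + INR (S n)) (1 + INR (S n))).
    assert (U := Rhat_antitone (1 + INR n) (1 + INR n) (a + INR (S n)) (b + INR (S n))).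
    rewrite S_INR in L, U at 1 2 3 4; rewrite S_INR in E1, Eab.
    rewrite shift_sum_S in E1.
    specialize (L ltac:(lra) ltac:(lra) ltac:(lra) ltac:(lra)).
    specialize (U ltac:(lra) ltac:(lra) ltac:(lra) ltac:(lra)).
    unfold g; rewrite (shift_sum_S _ 1); rewrite ?S_INR in L, U; lra.
  - apply is_lim_seq_const.
  - replace 0 with (2 * 0) by ring.
    apply (is_lim_seq_scal_l _ _ (Finite 0)), is_lim_seq_inv_shift. }
apply is_lim_seq_unique in H2; apply is_lim_seq_unique in H3.
rewrite H2 in H3; injection H3; lra.
Qed.

(** * The hypergeometric function near 1 *)

Lemma CV_radius_ge_1 (s : nat -> R) (M x : R) (hs : forall n, Rabs (s n) <= M)
  (hx : Rabs x < 1) : Rbar_lt (Rabs x) (CV_radius s).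
Proof.
apply Rbar_lt_le_trans with 1; [exact hx|].
apply (CV_radius_bounded s); exists M; intros n; rewrite pow1, Rmult_1_r; apply hs.
Qed.

Lemma vcoef_nonneg (a b : R) (n : nat) (ha : 0 < a) (hb : 0 < b) : 0 <= vcoef a b n.
Proof. apply Rmult_le_pos; [apply pos_INR | left; apply hcoef_pos; assumption]. Qed.

Lemma hcoef_S_le (a b : R) (n : nat) (ha : 0 < a) (hb : 0 < b) :
  hcoef a b (S n) <= hlim a b / INR (S n).
Proof.
assert (Hn : 0 < INR (S n)) by (apply lt_0_INR; lia).
apply Rmult_le_reg_r with (INR (S n)); [assumption|].
replace (hlim a b / INR (S n) * INR (S n)) with (hlim a b) by (field; lra).
rewrite Rmult_comm; apply (vcoef_le_hlim a b (S n)); assumption.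
Qed.

Lemma CV_radius_hcoef (a b x : R) (ha : 0 < a) (hb : 0 < b) (hx : Rabs x < 1) :
  Rbar_lt (Rabs x) (CV_radius (hcoef a b)).
Proof.
apply CV_radius_ge_1 with (1 + hlim a b); [|assumption].
assert (HC := hlim_pos a b ha hb).
intros n; rewrite Rabs_pos_eq by (left; apply hcoef_pos; assumption).
destruct n as [|n]; [rewrite hcoef_0; lra|].
apply Rle_trans with (1 := hcoef_S_le a b n ha hb).
assert (1 <= INR (S n)) by (rewrite S_INR; assert (H := pos_INR n); lra).
apply Rle_trans with (hlim a b / 1); [|lra].
apply Rmult_le_compat_l; [lra|]; apply Rinv_le_contravar; lra.
Qed.

Lemma dcoef_le (a b : R) (n : nat) (ha : 0 < a) (hb : 0 < b) : dcoef a b n <= hlim a b.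
Proof.
assert (H := vcoef_S a b n ha hb); assert (H1 := vcoef_le_hlim a b (S n) ha hb).
assert (H2 := vcoef_nonneg a b n ha hb); lra.
Qed.

Lemma CV_radius_dcoef (a b x : R) (ha : 0 < a) (hb : 0 < b) (hx : Rabs x < 1) :
  Rbar_lt (Rabs x) (CV_radius (dcoef a b)).
Proof.
apply CV_radius_ge_1 with (hlim a b); [|assumption].
intros n; rewrite Rabs_pos_eq by (left; apply dcoef_pos; assumption).
apply dcoef_le; assumption.
Qed.

(** Defining [T] by its coefficients makes the positivity of [T] and [T'] and the behaviour at 1
    immediate; [Tfun_deriv_hyp2F1] identifies it with [(1 - x) F']. *)
Definition Tfun (a b x : R) : R := PSeries (dcoef a b) x.
Definition Tfun' (a b x : R) : R := PSeries (PS_derive (dcoef a b)) x.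

Lemma hyp2F1_PSeries (a b x : R) : hyp2F1 a b (a + b) x = PSeries (hcoef a b) x.
Proof. apply Series_ext; intros n; unfold hcoef, Rdiv; ring. Qed.

Lemma Tfun_deriv_hyp2F1 (a b x : R) (ha : 0 < a) (hb : 0 < b) (hx : Rabs x < 1) :
  Tfun a b x = (1 - x) * PSeries (PS_derive (hcoef a b)) x.
Proof.
assert (Hex : ex_pseries (PS_derive (hcoef a b)) x).
{ apply ex_pseries_derive, CV_radius_hcoef; assumption. }
rewrite Rmult_minus_distr_r, Rmult_1_l, <- PSeries_incr_1, <- PSeries_minus.
- apply PSeries_ext; intros n; unfold PS_minus, PS_opp, PS_plus, PS_derive, opp, plus; simpl.
  destruct n as [|n].
  + unfold PS_incr_1, dcoef; rewrite hcoef_S, hcoef_0 by assumption; simpl; unfold zero; simpl; field; lra.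
  + change (PS_incr_1 (fun n0 => INR (S n0) * hcoef a b (S n0)) (S n)) with (vcoef a b (S n)).
    change (dcoef a b (S n) = vcoef a b (S (S n)) + - vcoef a b (S n)).
    rewrite (vcoef_S a b (S n)) by assumption; ring.
- assumption.
- apply ex_pseries_incr_1; assumption.
Qed.

Lemma is_derive_hyp2F1 (a b x : R) (ha : 0 < a) (hb : 0 < b) (hx : Rabs x < 1) :
  is_derive (hyp2F1 a b (a + b)) x (Tfun a b x / (1 - x)).
Proof.
apply is_derive_ext with (PSeries (hcoef a b)).
{ intros; rewrite hyp2F1_PSeries; reflexivity. }
assert (H := Rabs_def2 _ _ hx).
rewrite Tfun_deriv_hyp2F1 by assumption.
replace ((1 - x) * PSeries (PS_derive (hcoef a b)) x / (1 - x))
  with (PSeries (PS_derive (hcoef a b)) x) by (field; lra).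
apply is_derive_PSeries, CV_radius_hcoef; assumption.
Qed.

Lemma is_derive_Tfun (a b x : R) (ha : 0 < a) (hb : 0 < b) (hx : Rabs x < 1) :
  is_derive (Tfun a b) x (Tfun' a b x).
Proof. apply is_derive_PSeries, CV_radius_dcoef; assumption. Qed.

Lemma is_derive_Tfun' (a b x : R) (ha : 0 < a) (hb : 0 < b) (hx : Rabs x < 1) :
  is_derive (Tfun' a b) x (PSeries (PS_derive (PS_derive (dcoef a b))) x).
Proof.
apply is_derive_PSeries; rewrite CV_radius_derive; apply CV_radius_dcoef; assumption.
Qed.

(* The hypergeometric equation as a first-order system in [F] and [T = (1 - x) F']. *)
Lemma Tfun_ode (a b x : R) (ha : 0 < a) (hb : 0 < b) (hx : Rabs x < 1) :
  x * Tfun' a b x = a * b * hyp2F1 a b (a + b) x - (a + b) * Tfun a b x.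
Proof.
assert (Hd : ex_pseries (dcoef a b) x) by (apply CV_radius_inside, CV_radius_dcoef; assumption).
assert (Hh : ex_pseries (hcoef a b) x) by (apply CV_radius_inside, CV_radius_hcoef; assumption).
rewrite hyp2F1_PSeries; unfold Tfun, Tfun'.
rewrite <- PSeries_incr_1, <- !PSeries_scal, <- PSeries_minus.
- apply PSeries_ext; intros n; unfold PS_minus, PS_opp, PS_plus, PS_scal, PS_derive, opp, plus, scal; simpl; unfold mult; simpl.
  assert (H : a * b * hcoef a b n = (a + b + INR n) * dcoef a b n).
  { unfold dcoef; assert (H := pos_INR n); field; lra. }
  rewrite H; destruct n as [|n]; [simpl; unfold zero; simpl; ring|].
  unfold PS_incr_1; simpl; ring.
- apply ex_pseries_scal; [apply Rmult_comm|assumption].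
- apply ex_pseries_scal; [apply Rmult_comm|assumption].
Qed.

Lemma PSeries_ge_coef_0 (s : nat -> R) (x : R) (hs : forall n, 0 <= s n) (hx : 0 <= x)
  (hr : Rbar_lt (Rabs x) (CV_radius s)) : s 0%nat <= PSeries s x.
Proof.
assert (H : ex_series (fun n => s n * x ^ n)) by (apply ex_pseries_R, CV_radius_inside, hr).
assert (H' : is_lim_seq (sum_n (fun n => s n * x ^ n)) (PSeries s x)) by exact (Series_correct _ H).
replace (s 0%nat) with (sum_n (fun n => s n * x ^ n) 0) by (rewrite sum_O; simpl; ring).
apply (is_lim_seq_incr_compare _ _ H').
intros n; rewrite sum_Sn; unfold plus; simpl.
assert (0 <= s (S n) * (x * x ^ n)); [|lra].
apply Rmult_le_pos; [apply hs|apply (pow_le x (S n)); assumption].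
Qed.

Lemma hyp2F1_ge_1 (a b x : R) (ha : 0 < a) (hb : 0 < b) (hx : 0 <= x < 1) :
  1 <= hyp2F1 a b (a + b) x.
Proof.
rewrite hyp2F1_PSeries, <- (hcoef_0 a b); apply PSeries_ge_coef_0; [|lra|].
- intros; left; apply hcoef_pos; assumption.
- apply CV_radius_hcoef; auto; rewrite Rabs_pos_eq; lra.
Qed.

Lemma Tfun_pos (a b x : R) (ha : 0 < a) (hb : 0 < b) (hx : 0 <= x < 1) : 0 < Tfun a b x.
Proof.
apply Rlt_le_trans with (dcoef a b 0); [apply dcoef_pos; assumption|].
apply PSeries_ge_coef_0; [|lra|].
- intros; left; apply dcoef_pos; assumption.
- apply CV_radius_dcoef; auto; rewrite Rabs_pos_eq; lra.
Qed.

Lemma Tfun'_pos (a b x : R) (ha : 0 < a) (hb : 0 < b) (hx : 0 <= x < 1) : 0 < Tfun' a b x.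
Proof.
assert (Hp : forall n, 0 < PS_derive (dcoef a b) n).
{ intros n; apply Rmult_lt_0_compat; [apply lt_0_INR; lia | apply dcoef_pos; assumption]. }
apply Rlt_le_trans with (PS_derive (dcoef a b) 0); [apply Hp|].
apply PSeries_ge_coef_0; [intros; left; apply Hp|lra|].
rewrite CV_radius_derive; apply CV_radius_dcoef; auto; rewrite Rabs_pos_eq; lra.
Qed.

Lemma hyp2F1_at_0 (a b : R) : hyp2F1 a b (a + b) 0 = 1.
Proof. rewrite hyp2F1_PSeries, PSeries_0; apply hcoef_0. Qed.

Lemma Tfun_at_0 (a b : R) : Tfun a b 0 = a * b / (a + b).
Proof.
unfold Tfun; rewrite PSeries_0; unfold dcoef; rewrite hcoef_0; simpl.
rewrite Rplus_0_r, Rmult_1_r; reflexivity.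
Qed.

Lemma Tfun'_at_0 (a b : R) (ha : 0 < a) (hb : 0 < b) :
  Tfun' a b 0 = (a * b) ^ 2 / ((a + b) * (a + b + 1)).
Proof.
unfold Tfun'; rewrite PSeries_0; unfold PS_derive, dcoef.
rewrite hcoef_S, hcoef_0 by assumption; simpl; field; lra.
Qed.

(** The geometric series is integrated termwise and in closed form. The factor [x] stands outside so
    that the indices match those of [scoef]. *)
Lemma neg_ln_series (x : R) (hx : 0 <= x < 1) :
  - ln (1 - x) = x * PSeries (fun n => / INR (S n)) x.
Proof.
assert (Hr : forall t, Rabs t < 1 -> Rbar_lt (Rabs t) (CV_radius (fun _ => 1))).
{ intros t Ht; apply CV_radius_ge_1 with 1; auto; intros; rewrite Rabs_R1; lra. }
assert (H1 : is_RInt (PSeries (fun _ => 1)) 0 x (PSeries (PS_Int (fun _ => 1)) x)).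
{ apply is_RInt_PSeries, Hr; rewrite Rabs_pos_eq; lra. }
assert (Hg : forall t, 0 <= t < 1 -> PSeries (fun _ => 1) t = / (1 - t)).
{ intros t Ht; unfold PSeries; rewrite <- Series_geom by (rewrite Rabs_pos_eq; lra).
  apply Series_ext; intros; ring. }
assert (H2 : is_RInt (PSeries (fun _ => 1)) 0 x (minus (- ln (1 - x)) (- ln (1 - 0)))).
{ apply (is_RInt_derive (fun t => - ln (1 - t))); rewrite Rmin_left, Rmax_right by lra; intros t Ht.
  - rewrite Hg by lra; auto_derive; [lra|field; lra].
  - apply continuity_pt_filterlim, PSeries_continuity, Hr; rewrite Rabs_pos_eq; lra. }
assert (E1 := is_RInt_unique (PSeries (fun _ => 1)) _ _ _ H1).
rewrite (is_RInt_unique (PSeries (fun _ => 1)) _ _ _ H2) in E1; clear H2; rename E1 into H2; symmetry in H2.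
rewrite PSeries_decr_1_aux in H2 by reflexivity.
rewrite Rminus_0_r, ln_1 in H2; unfold minus, plus, opp in H2; simpl in H2.
replace (- ln (1 - x)) with (- ln (1 - x) + - - 0) by ring; rewrite <- H2; f_equal.
apply PSeries_ext; intros n; unfold PS_decr_1, PS_Int, Rdiv; rewrite Rmult_1_l; reflexivity.
Qed.

(** For [n >= 1] the coefficient is at most [a b C / n^2], and [(n + 1)^2 <= 4 n^2] gives the 4; the
    extra 1 covers [n = 0], where [dcoef <= C]. *)
Lemma dcoef_sq_bound (a b : R) (n : nat) (ha : 0 < a) (hb : 0 < b) :
  Rabs (dcoef a b n) <= (4 * (a * b) + 1) * hlim a b / INR (S n) ^ 2.
Proof.
assert (HC := hlim_pos a b ha hb).
assert (Hab : 0 < a * b) by (apply Rmult_lt_0_compat; assumption).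
rewrite Rabs_pos_eq by (left; apply dcoef_pos; assumption).
destruct n as [|n].
- apply Rle_trans with (1 := dcoef_le a b 0 ha hb); simpl; rewrite !Rmult_1_r; unfold Rdiv.
  rewrite Rinv_1; nra.
- assert (H := hcoef_S_le a b n ha hb).
  assert (Hn := pos_INR n); unfold dcoef; rewrite (S_INR (S n)); rewrite (S_INR n) in *.
  set (m := INR n + 1) in *; assert (Hm : 1 <= m) by (unfold m; lra).
  apply Rle_trans with (a * b * (hlim a b / m) / m).
  + apply Rmult_le_compat; try (apply Rmult_le_pos; [lra|left; apply hcoef_pos; assumption]).
    * left; apply Rinv_0_lt_compat; lra.
    * apply Rmult_le_compat_l; lra.
    * apply Rinv_le_contravar; lra.
  + apply Rmult_le_reg_r with (m ^ 2 * (m + 1) ^ 2).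
    { apply Rmult_lt_0_compat; apply pow_lt; lra. }
    replace (a * b * (hlim a b / m) / m * (m ^ 2 * (m + 1) ^ 2))
      with (hlim a b * (a * b) * (m + 1) ^ 2) by (field; lra).
    replace ((4 * (a * b) + 1) * hlim a b / (m + 1) ^ 2 * (m ^ 2 * (m + 1) ^ 2))
      with (hlim a b * ((4 * (a * b) + 1) * m ^ 2)) by (field; lra).
    rewrite Rmult_assoc; apply Rmult_le_compat_l; [lra|].
    assert ((m + 1) ^ 2 <= 4 * m ^ 2) by nra.
    assert (0 <= m ^ 2) by (apply pow_le; lra); nra.
Qed.

Lemma Tfun_asymptotic (a b x : R) (ha : 0 < a) (hb : 0 < b) (hx : 0 <= x < 1) :
  Rabs (1 - Tfun a b x / hlim a b) <= 3 * (4 * (a * b) + 1) * sqrt (1 - x).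
Proof.
assert (HC := hlim_pos a b ha hb).
assert (H := Abel_rate (dcoef a b) (fun n => x ^ n) x ((4 * (a * b) + 1) * hlim a b) ltac:(lra)
  (fun n => dcoef_sq_bound a b n ha hb)).
rewrite (is_series_unique _ _ (is_series_dcoef a b ha hb)) in H.
replace (1 - Tfun a b x / hlim a b) with (/ hlim a b * (hlim a b - Tfun a b x)) by (field; lra).
rewrite Rabs_mult, Rabs_pos_eq by (left; apply Rinv_0_lt_compat; assumption).
apply Rmult_le_reg_l with (hlim a b); [assumption|].
rewrite <- Rmult_assoc, Rinv_r, Rmult_1_l by lra.
eapply Rle_trans; [apply H|right; ring].
intros n; assert (0 <= x ^ n <= 1).
{ split; [apply pow_le; lra|]; rewrite <- (pow1 n); apply pow_incr; lra. }
simpl; nra.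
Qed.

Lemma hyp2F1_asymptotic (a b x : R) (ha : 0 < a) (hb : 0 < b) (hx : 0 <= x < 1) :
  Rabs (Rhat a b - (hyp2F1 a b (a + b) x / hlim a b + ln (1 - x))) <= 6 * (a * b) * sqrt (1 - x).
Proof.
assert (HC := hlim_pos a b ha hb).
assert (Hx : Rabs x < 1) by (rewrite Rabs_pos_eq; lra).
assert (H := Abel_rate (scoef a b) (fun n => x ^ S n) x (2 * (a * b)) ltac:(lra)
  (fun n => scoef_bound a b n ha hb)).
replace (Rhat a b - (hyp2F1 a b (a + b) x / hlim a b + ln (1 - x)))
  with (Series (scoef a b) - Series (fun n => scoef a b n * x ^ S n)).
{ eapply Rle_trans; [apply H|right; ring].
  intros n; assert (0 <= x ^ S n <= 1).
  { split; [apply pow_le; lra|]; rewrite <- (pow1 (S n)); apply pow_incr; lra. }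
  simpl in *; lra. }
assert (Eh : hyp2F1 a b (a + b) x = 1 + x * PSeries (PS_decr_1 (hcoef a b)) x).
{ rewrite hyp2F1_PSeries, PSeries_decr_1, hcoef_0; [reflexivity|].
  apply CV_radius_inside, CV_radius_hcoef; assumption. }
assert (El := neg_ln_series x hx).
assert (Es : Series (fun n => scoef a b n * x ^ S n) =
   x * (/ hlim a b * PSeries (PS_decr_1 (hcoef a b)) x - PSeries (fun n => / INR (S n)) x)).
{ rewrite <- PSeries_scal, <- PSeries_minus.
  - unfold PSeries; rewrite <- (Series_scal_l x); apply Series_ext; intros n.
    rewrite scoef_hcoef; unfold PS_minus, PS_plus, PS_opp, PS_scal, PS_decr_1, plus, opp, scal; simpl; unfold mult; simpl.
    unfold Rdiv; ring.
  - apply ex_pseries_scal; [apply Rmult_comm|].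
    apply CV_radius_inside; rewrite CV_radius_decr_1; apply CV_radius_hcoef; assumption.
  - apply CV_radius_inside, CV_radius_ge_1 with 1; auto.
    intros n; rewrite Rabs_pos_eq by (left; apply Rinv_0_lt_compat, lt_0_INR; lia).
    rewrite <- Rinv_1; apply Rinv_le_contravar; [lra|].
    rewrite S_INR; assert (Hn := pos_INR n); lra. }
rewrite Es, Eh; unfold Rhat; rewrite <- (Ropp_involutive (ln (1 - x))), El.
field; lra.
Qed.

(** * Monotonicity of [ratioH] *)

(** If [Y t <= 0], then [Y] has a minimiser on [[0, t]] at a positive point with nonpositive value:
    if the minimum is at 0, its value is 0 and [t] is a minimiser too. Just left of that point a
    positive derivative gives a smaller value. *)
Lemma pos_of_deriv_pos_when_nonpos (Y Y' : R -> R) (Y0 : Y 0 = 0)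
  (hd : forall x, 0 <= x < 1 -> is_derive Y x (Y' x))
  (hp : forall x, 0 < x < 1 -> Y x <= 0 -> 0 < Y' x) :
  forall x, 0 < x < 1 -> 0 < Y x.
Proof.
intros t Ht; apply Rnot_le_lt; intros Hle.
assert (Hmin : forall m, 0 < m <= t -> Y m <= 0 -> ~ (forall s, 0 <= s <= t -> Y m <= Y s)).
{ intros m Hm Hm0 Hall.
  assert (HD := hd m ltac:(lra)); apply is_derive_Reals in HD.
  assert (Hpos := hp m ltac:(lra) Hm0).
  destruct (HD (Y' m) Hpos) as [d Hd].
  set (h := Rmin (d / 2) m); assert (Hdp := cond_pos d).
  assert (h1 : 0 < h) by (apply Rmin_glb_lt; lra).
  assert (h2 : h <= d / 2) by apply Rmin_l.
  assert (h3 : h <= m) by apply Rmin_r.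
  specialize (Hd (- h) ltac:(lra)).
  rewrite Rabs_Ropp, Rabs_pos_eq in Hd by lra.
  specialize (Hd ltac:(lra)); apply Rabs_def2 in Hd.
  specialize (Hall (m + - h) ltac:(lra)).
  assert (0 < (Y (m + - h) - Y m) / - h) by lra.
  assert ((Y (m + - h) - Y m) / - h <= 0); [|lra].
  replace ((Y (m + - h) - Y m) / - h) with (- ((Y (m + - h) - Y m) / h)) by (field; lra).
  assert (0 <= (Y (m + - h) - Y m) / h); [|lra].
  apply Rmult_le_pos; [lra|left; apply Rinv_0_lt_compat; assumption]. }
destruct (continuity_ab_min Y 0 t ltac:(lra)) as (m & Hm & Hm').
{ intros s Hs; apply derivable_continuous_pt; exists (Y' s).
  apply is_derive_Reals, hd; lra. }
destruct (Req_dec m 0) as [->|Hm0].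
- apply (Hmin t ltac:(lra) Hle).
  intros s Hs; specialize (Hm s Hs); lra.
- apply (Hmin m ltac:(lra)); [|exact Hm].
  specialize (Hm t ltac:(lra)); lra.
Qed.

Lemma derive_pos_increasing (f f' : R -> R) (lo hi : R)
  (hf : forall x, lo < x < hi -> is_derive f x (f' x))
  (hp : forall x, lo < x < hi -> 0 < f' x) (x y : R) :
  lo < x -> x < y -> y < hi -> f x < f y.
Proof.
intros Hx Hxy Hy.
destruct (MVT_cor2 f f' x y Hxy) as (z & Hz & Hz').
{ intros z Hz; apply is_derive_Reals, hf; lra. }
assert (H := hp z ltac:(lra)); nra.
Qed.

(** The interval is arbitrary because the necessity halves of the theorem use only a neighbourhood
    of one endpoint. *)
Lemma strict_convex_of_second_derivative (f f' f'' : R -> R) (lo hi : R)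
  (hf : forall x, lo < x < hi -> is_derive f x (f' x))
  (hf' : forall x, lo < x < hi -> is_derive f' x (f'' x))
  (hp : forall x, lo < x < hi -> 0 < f'' x) :
  forall x y t, lo < x < hi -> lo < y < hi -> x <> y -> 0 < t < 1 ->
    f (t * x + (1 - t) * y) < t * f x + (1 - t) * f y.
Proof.
assert (H : forall x y t, lo < x < hi -> lo < y < hi -> x < y -> 0 < t < 1 ->
    f (t * x + (1 - t) * y) < t * f x + (1 - t) * f y).
{ intros x y t Hx Hy Hxy Ht; set (z := t * x + (1 - t) * y).
  assert (Hz1 : x < z) by (unfold z; nra); assert (Hz2 : z < y) by (unfold z; nra).
  destruct (MVT_cor2 f f' x z Hz1) as (u & Hu & Hu').
  { intros s Hs; apply is_derive_Reals, hf; lra. }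
  destruct (MVT_cor2 f f' z y Hz2) as (v & Hv & Hv').
  { intros s Hs; apply is_derive_Reals, hf; lra. }
  assert (Hm := derive_pos_increasing f' f'' lo hi hf' hp u v ltac:(lra) ltac:(lra) ltac:(lra)).
  replace (z - x) with ((1 - t) * (y - x)) in Hu by (unfold z; ring).
  replace (y - z) with (t * (y - x)) in Hv by (unfold z; ring).
  assert (E : t * f x + (1 - t) * f y - f z = t * (1 - t) * (y - x) * (f' v - f' u)).
  { replace (t * f x + (1 - t) * f y - f z)
      with ((1 - t) * (f y - f z) - t * (f z - f x)) by ring.
    rewrite Hu, Hv; ring. }
  assert (0 < t * (1 - t) * (y - x) * (f' v - f' u)); [|lra].
  repeat apply Rmult_lt_0_compat; lra. }
intros x y t Hx Hy Hxy Ht; destruct (Rtotal_order x y) as [h|[h|h]]; [auto|lra|].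
assert (H' := H y x (1 - t) Hy Hx h ltac:(lra)).
replace (1 - (1 - t)) with t in H' by ring.
replace (t * x + (1 - t) * y) with ((1 - t) * y + t * x) by ring; lra.
Qed.

Lemma strict_concave_of_second_derivative (f f' f'' : R -> R) (lo hi : R)
  (hf : forall x, lo < x < hi -> is_derive f x (f' x))
  (hf' : forall x, lo < x < hi -> is_derive f' x (f'' x))
  (hp : forall x, lo < x < hi -> f'' x < 0) :
  forall x y t, lo < x < hi -> lo < y < hi -> x <> y -> 0 < t < 1 ->
    t * f x + (1 - t) * f y < f (t * x + (1 - t) * y).
Proof.
intros x y t Hx Hy Hxy Ht.
assert (H := strict_convex_of_second_derivative (fun x => - f x) (fun x => - f' x)
  (fun x => - f'' x) lo hi).
specialize (H (fun x Hx => is_derive_opp f x _ (hf x Hx))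
  (fun x Hx => is_derive_opp f' x _ (hf' x Hx))).
specialize (H (fun x Hx => Ropp_0_gt_lt_contravar _ (hp x Hx)) x y t Hx Hy Hxy Ht).
simpl in H; lra.
Qed.

Lemma prod_le_quarter_sq (a b : R) : 4 * (a * b) <= (a + b) ^ 2.
Proof. assert (0 <= (a - b) ^ 2) by apply pow2_ge_0; simpl in *; nra. Qed.

(* The value of [e^t - 1 = x / (1 - x)] at which [ratioH] would be stationary, given
   [w = T / F]. *)
Definition Zcurve (p q w : R) : R :=
  (q - p * w) * (1 + p - 3 * q - (2 - p) * w) / ((p - 2 * q) * w ^ 2).

Definition Zcurve' (p q w : R) : R :=
  (((2 - p) * q + p * (1 + p - 3 * q)) * w - 2 * q * (1 + p - 3 * q)) / ((p - 2 * q) * w ^ 3).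

Lemma is_derive_Zcurve (p q w : R) (hA : 0 < p - 2 * q) (hw : 0 < w) :
  is_derive (Zcurve p q) w (Zcurve' p q w).
Proof.
unfold Zcurve, Zcurve'; auto_derive.
- simpl; rewrite Rmult_1_r; apply Rgt_not_eq; repeat apply Rmult_lt_0_compat; lra.
- field; lra.
Qed.

Lemma Zcurve_factors_pos (p q w : R) (hp : 0 < p <= 1) (hq : 0 < q) (hpq : 4 * q <= p ^ 2)
  (hw : 0 < w) (hwq : p * w < q) :
  0 < p - 2 * q /\ 0 < 1 - 2 * w /\ 0 < 1 + p - 3 * q - 2 * (2 - p) * w /\
  0 < 1 + p - 3 * q - 2 * (1 - q) * w.
Proof.
simpl in hpq; assert (4 * w < p) by nra.
repeat split; nra.
Qed.

Lemma Zcurve_pos (p q w : R) (hp : 0 < p <= 1) (hq : 0 < q) (hpq : 4 * q <= p ^ 2)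
  (hw : 0 < w) (hwq : p * w < q) : 0 < Zcurve p q w.
Proof.
destruct (Zcurve_factors_pos p q w hp hq hpq hw hwq) as (H1 & H2 & H3 & H4).
apply Rdiv_lt_0_compat; apply Rmult_lt_0_compat; try lra; apply pow_lt; assumption.
Qed.

Lemma Zcurve'_neg (p q w : R) (hp : 0 < p <= 1) (hq : 0 < q) (hpq : 4 * q <= p ^ 2)
  (hw : 0 < w) (hwq : p * w < q) : Zcurve' p q w < 0.
Proof.
destruct (Zcurve_factors_pos p q w hp hq hpq hw hwq) as (H1 & H2 & H3 & H4).
unfold Zcurve'; apply Rmult_neg_pos.
- assert (p * w * (1 + p - 3 * q) < q * (1 + p - 3 * q)) by (apply Rmult_lt_compat_r; nra).
  assert (q * ((2 - p) * w) < q * (1 + p - 3 * q)) by (apply Rmult_lt_compat_l; nra).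
  lra.
- apply Rinv_0_lt_compat, Rmult_lt_0_compat; [assumption|apply pow_lt; assumption].
Qed.

(** This is the derivative of [x - (1 - x) Z(w)] with [x / (1 - x)] replaced by [Z(w)] in the
    Riccati equation: what [Ybar'] would be at a zero of [Ybar]. It depends on [w] alone, and its
    numerator splits into the three linear factors. *)
Lemma Zcurve_barrier (p q w : R) (hp : 0 < p <= 1) (hq : 0 < q) (hpq : 4 * q <= p ^ 2)
  (hw : 0 < w) (hwq : p * w < q) :
  0 < 1 + Zcurve p q w - Zcurve' p q w * ((q - p * w) / Zcurve p q w - w ^ 2).
Proof.
destruct (Zcurve_factors_pos p q w hp hq hpq hw hwq) as (H1 & H2 & H3 & H4).
assert (Hm : 0 < 1 + p - 3 * q - (2 - p) * w) by nra.
replace (1 + Zcurve p q w - Zcurve' p q w * ((q - p * w) / Zcurve p q w - w ^ 2))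
  with ((q - p * w) * (1 + p - 3 * q - 2 * (2 - p) * w) * (1 + p - 3 * q - 2 * (1 - q) * w)
    / ((p - 2 * q) * w ^ 2 * (1 + p - 3 * q - (2 - p) * w)))
  by (unfold Zcurve, Zcurve'; field; repeat split; lra).
apply Rdiv_lt_0_compat; repeat apply Rmult_lt_0_compat; try lra; apply pow_lt; assumption.
Qed.

Definition wfun (a b x : R) : R := Tfun a b x / hyp2F1 a b (a + b) x.

Definition wfun' (a b x : R) : R :=
  Tfun' a b x / hyp2F1 a b (a + b) x - wfun a b x ^ 2 / (1 - x).

Lemma is_derive_wfun (a b x : R) (ha : 0 < a) (hb : 0 < b) (hx : 0 <= x < 1) :
  is_derive (wfun a b) x (wfun' a b x).
Proof.
assert (Hx : Rabs x < 1) by (rewrite Rabs_pos_eq; lra).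
assert (HF := hyp2F1_ge_1 a b x ha hb hx).
assert (D1 := is_derive_hyp2F1 a b x ha hb Hx).
assert (D2 := is_derive_Tfun a b x ha hb Hx).
assert (D := is_derive_div _ _ _ _ _ D2 D1 ltac:(lra)).
replace (wfun' a b x) with ((Tfun' a b x * hyp2F1 a b (a + b) x - Tfun a b x * (Tfun a b x / (1 - x))) /
   hyp2F1 a b (a + b) x ^ 2) by (unfold wfun', wfun; field; lra).
exact D.
Qed.

Lemma Tfun'_wfun (a b x : R) (ha : 0 < a) (hb : 0 < b) (hx : 0 < x < 1) :
  Tfun' a b x / hyp2F1 a b (a + b) x = (a * b - (a + b) * wfun a b x) / x.
Proof.
assert (HF := hyp2F1_ge_1 a b x ha hb ltac:(lra)).
assert (H := Tfun_ode a b x ha hb ltac:(rewrite Rabs_pos_eq; lra)).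
replace (Tfun' a b x) with ((a * b * hyp2F1 a b (a + b) x - (a + b) * Tfun a b x) / x)
  by (rewrite <- H; field; lra).
unfold wfun; field; lra.
Qed.

Lemma wfun_pos (a b x : R) (ha : 0 < a) (hb : 0 < b) (hx : 0 <= x < 1) : 0 < wfun a b x.
Proof.
assert (HF := hyp2F1_ge_1 a b x ha hb hx).
apply Rdiv_lt_0_compat; [apply Tfun_pos; assumption | lra].
Qed.

Lemma wfun_lt (a b x : R) (ha : 0 < a) (hb : 0 < b) (hx : 0 < x < 1) :
  (a + b) * wfun a b x < a * b.
Proof.
assert (HF := hyp2F1_ge_1 a b x ha hb ltac:(lra)).
assert (H := Tfun'_wfun a b x ha hb hx).
assert (HT : 0 < Tfun' a b x / hyp2F1 a b (a + b) x)
  by (apply Rdiv_lt_0_compat; [apply Tfun'_pos; auto; lra | lra]).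
apply Rmult_lt_compat_r with (r := x) in HT; [|lra].
rewrite H in HT; replace ((a * b - (a + b) * wfun a b x) / x * x)
  with (a * b - (a + b) * wfun a b x) in HT by (field; lra); lra.
Qed.

Lemma wfun_at_0 (a b : R) : wfun a b 0 = a * b / (a + b).
Proof. unfold wfun; rewrite hyp2F1_at_0, Tfun_at_0; apply Rdiv_1_r. Qed.

Definition Ybar (a b x : R) : R := x - (1 - x) * Zcurve (a + b) (a * b) (wfun a b x).

Lemma Ybar_pos (a b : R) (ha : 0 < a) (hb : 0 < b) (hab : a + b <= 1) :
  forall x, 0 < x < 1 -> 0 < Ybar a b x.
Proof.
assert (hq : 0 < a * b) by (apply Rmult_lt_0_compat; assumption).
assert (hpq := prod_le_quarter_sq a b).
assert (hA : 0 < (a + b) - 2 * (a * b)) by (simpl in hpq; nra).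
apply pos_of_deriv_pos_when_nonpos with (fun x => 1 + Zcurve (a + b) (a * b) (wfun a b x)
   - (1 - x) * (wfun' a b x * Zcurve' (a + b) (a * b) (wfun a b x))).
- unfold Ybar; rewrite wfun_at_0; unfold Zcurve; field.
  repeat split; lra.
- intros x Hx; unfold Ybar.
  assert (Hw := wfun_pos a b x ha hb Hx).
  assert (D : is_derive (fun x => Zcurve (a + b) (a * b) (wfun a b x)) x
     (wfun' a b x * Zcurve' (a + b) (a * b) (wfun a b x))).
  { apply (is_derive_comp (Zcurve (a + b) (a * b)) (wfun a b)).
    - apply is_derive_Zcurve; assumption.
    - apply is_derive_wfun; assumption. }
  assert (G : forall (g : R -> R) l, is_derive g x l ->
    is_derive (fun x => x - (1 - x) * g x) x (1 + g x - (1 - x) * l)).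
  { intros g l Hg; auto_derive; [eexists; exact Hg|].
    replace (Derive (fun y => g y) x) with l by (symmetry; apply is_derive_unique, Hg); ring. }
  exact (G _ _ D).
- intros x Hx HY; unfold Ybar in HY; unfold wfun'.
  assert (Hw := wfun_pos a b x ha hb ltac:(lra)).
  assert (Hwq := wfun_lt a b x ha hb Hx).
  rewrite Tfun'_wfun by assumption.
  assert (hp : 0 < a + b <= 1) by lra.
  set (p := a + b) in *; set (q := a * b) in *; set (w := wfun a b x) in *.
  assert (HZ := Zcurve_pos p q w hp hq hpq Hw Hwq).
  assert (HZ' := Zcurve'_neg p q w hp hq hpq Hw Hwq).
  assert (HB := Zcurve_barrier p q w hp hq hpq Hw Hwq).
  apply Rlt_le_trans with (1 := HB).
  replace ((1 - x) * (((q - p * w) / x - w ^ 2 / (1 - x)) * Zcurve' p q w))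
    with (Zcurve' p q w * ((q - p * w) * ((1 - x) / x) - w ^ 2)) by (field; lra).
  (* This restates [Ybar <= 0]. It bounds [(1 - x) w'] below by its value on the curve, and since
     [Zcurve'] is negative the true derivative is at least the barrier expression. *)
  assert (/ Zcurve p q w <= (1 - x) / x).
  { apply Rmult_le_reg_r with (Zcurve p q w * x); [apply Rmult_lt_0_compat; lra|].
    replace (/ Zcurve p q w * (Zcurve p q w * x)) with x by (field; lra).
    replace ((1 - x) / x * (Zcurve p q w * x)) with ((1 - x) * Zcurve p q w) by (field; lra).
    lra. }
  assert ((q - p * w) * / Zcurve p q w <= (q - p * w) * ((1 - x) / x))
    by (apply Rmult_le_compat_l; lra).
  unfold Rdiv at 1; nra.
Qed.

(** This is [1 / (H + L)]. It is written with [T' / F] instead of [(q - p w) / x] so that it is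
    regular at 0, where its reciprocal is [cab a b]. *)
Definition Kfun (a b x : R) : R :=
  wfun a b x + (1 - x) * (Tfun' a b x / hyp2F1 a b (a + b) x) / (1 - 2 * wfun a b x).

Definition ratioH (a b x : R) : R := / Kfun a b x + ln (1 - x).

Lemma Kfun_eq (a b x : R) (ha : 0 < a) (hb : 0 < b) (hx : 0 < x < 1) :
  Kfun a b x =
  wfun a b x + (1 - x) * ((a * b - (a + b) * wfun a b x) / x) / (1 - 2 * wfun a b x).
Proof. unfold Kfun; rewrite Tfun'_wfun by assumption; reflexivity. Qed.

Lemma two_wfun_le_half (a b x : R) (ha : 0 < a) (hb : 0 < b) (hab : a + b <= 1)
  (hx : 0 <= x < 1) : 2 * wfun a b x <= 1 / 2.
Proof.
assert (hpq := prod_le_quarter_sq a b); simpl in hpq.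
destruct (Req_dec x 0) as [->|Hx0].
- rewrite wfun_at_0; apply Rmult_le_reg_r with (a + b); [lra|].
  field_simplify; [|lra]; nra.
- assert (H := wfun_lt a b x ha hb ltac:(lra)); nra.
Qed.

Lemma Kfun_gt_wfun (a b x : R) (ha : 0 < a) (hb : 0 < b) (hab : a + b <= 1)
  (hx : 0 <= x < 1) : wfun a b x < Kfun a b x.
Proof.
assert (H := two_wfun_le_half a b x ha hb hab hx).
assert (HF := hyp2F1_ge_1 a b x ha hb hx).
assert (HT := Tfun'_pos a b x ha hb hx).
unfold Kfun; assert (0 < (1 - x) * (Tfun' a b x / hyp2F1 a b (a + b) x) / (1 - 2 * wfun a b x)); [|lra].
apply Rdiv_lt_0_compat; [|lra]; apply Rmult_lt_0_compat; [lra|].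
apply Rdiv_lt_0_compat; lra.
Qed.

Lemma locally_01 (x : R) (P : R -> Prop) (hx : 0 < x < 1)
  (hP : forall y, 0 < y < 1 -> P y) : locally x P.
Proof.
assert (H : 0 < Rmin x (1 - x)) by (apply Rmin_glb_lt; lra).
exists (mkposreal _ H); intros y Hy; apply Rabs_lt_between' in Hy; simpl in Hy.
assert (H1 := Rmin_l x (1 - x)); assert (H2 := Rmin_r x (1 - x)); apply hP; lra.
Qed.

Lemma is_derive_ratioH (a b x : R) (ha : 0 < a) (hb : 0 < b) (hab : a + b <= 1)
  (hx : 0 < x < 1) :
  is_derive (ratioH a b) x
    (- ((a + b - 2 * (a * b)) * wfun a b x ^ 2 * Ybar a b x /
      (x ^ 2 * (1 - 2 * wfun a b x) ^ 2 * Kfun a b x ^ 2))).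
Proof.
assert (Hw := wfun_pos a b x ha hb ltac:(lra)).
assert (H2w := two_wfun_le_half a b x ha hb hab ltac:(lra)).
assert (HK := Kfun_gt_wfun a b x ha hb hab ltac:(lra)).
assert (hpq := prod_le_quarter_sq a b).
assert (hq : 0 < a * b) by (apply Rmult_lt_0_compat; assumption).
assert (hA : 0 < (a + b) - 2 * (a * b)) by (simpl in hpq; nra).
assert (Dw := is_derive_wfun a b x ha hb ltac:(lra)).
(* As [H = 1 / K - L], the sign of [H'] is opposite to that of [(1 - x) K' + K^2]. Substituting the
   Riccati equation makes this expression affine in [x / (1 - x)] up to a positive factor, and
   [Zcurve] is its root. *)
assert (DK : exists K', is_derive (Kfun a b) x K' /\
  (1 - x) * K' + Kfun a b x ^ 2 = (1 - x) * (a + b - 2 * (a * b)) * wfun a b x ^ 2 * Ybar a b x /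
      (x ^ 2 * (1 - 2 * wfun a b x) ^ 2)).
{ eexists; split.
  - eapply is_derive_ext_loc.
    + apply (locally_01 x _ hx); intros y Hy; symmetry; apply Kfun_eq; assumption.
    + auto_derive; [|reflexivity].
      repeat split; try lra; eexists; exact Dw.
  - replace (Derive (fun x0 => wfun a b x0) x) with (wfun' a b x) by (symmetry; apply is_derive_unique, Dw).
    rewrite Kfun_eq by assumption; unfold Ybar, Zcurve, wfun'; rewrite Tfun'_wfun by assumption.
    field; repeat split; lra. }
destruct DK as (K' & DK & EK).
unfold ratioH; auto_derive.
- repeat split; [eexists; exact DK|lra|lra].
- replace (Derive (fun x0 => Kfun a b x0) x) with K' by (symmetry; apply is_derive_unique, DK).
  replace ((a + b - 2 * (a * b)) * wfun a b x ^ 2 * Ybar a b x /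
    (x ^ 2 * (1 - 2 * wfun a b x) ^ 2 * Kfun a b x ^ 2))
  with (((1 - x) * (a + b - 2 * (a * b)) * wfun a b x ^ 2 * Ybar a b x /
      (x ^ 2 * (1 - 2 * wfun a b x) ^ 2)) / ((1 - x) * Kfun a b x ^ 2)) by (field; repeat split; lra).
  rewrite <- EK; field; lra.
Qed.

Lemma ratioH_decreasing (a b x y : R) (ha : 0 < a) (hb : 0 < b) (hab : a + b <= 1)
  (hx : 0 < x) (hxy : x < y) (hy : y < 1) : ratioH a b y < ratioH a b x.
Proof.
destruct (MVT_cor2 (ratioH a b) (fun z => - ((a + b - 2 * (a * b)) * wfun a b z ^ 2 * Ybar a b z /
      (z ^ 2 * (1 - 2 * wfun a b z) ^ 2 * Kfun a b z ^ 2))) x y hxy) as (z & E & Hz).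
{ intros z Hz; apply is_derive_Reals, is_derive_ratioH; lra. }
assert (HY := Ybar_pos a b ha hb hab z ltac:(lra)).
assert (Hw := wfun_pos a b z ha hb ltac:(lra)).
assert (H2w := two_wfun_le_half a b z ha hb hab ltac:(lra)).
assert (HK := Kfun_gt_wfun a b z ha hb hab ltac:(lra)).
assert (hpq := prod_le_quarter_sq a b).
assert (hA : 0 < (a + b) - 2 * (a * b)) by (simpl in hpq; nra).
assert (0 < (a + b - 2 * (a * b)) * wfun a b z ^ 2 * Ybar a b z /
      (z ^ 2 * (1 - 2 * wfun a b z) ^ 2 * Kfun a b z ^ 2)).
{ apply Rdiv_lt_0_compat; repeat first [lra | apply pow_lt | apply Rmult_lt_0_compat]. }
nra.
Qed.

(** * Limits of [ratioH] and the second derivative of [phi] *)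

Definition I01 (x : R) : Prop := 0 < x < 1.

Lemma limit1_squeeze (f g : R -> R) (D : R -> Prop) (l x0 : R)
  (hfg : forall x, D x -> Rabs (f x - l) <= g x) (hg : limit1_in g D 0 x0) :
  limit1_in f D l x0.
Proof.
intros eps Heps; destruct (hg eps Heps) as (d & Hd & H); exists d; split; [exact Hd|].
intros x [Dx Hx]; specialize (H x (conj Dx Hx)); simpl in *; unfold Rdist in *.
rewrite Rminus_0_r in H; specialize (hfg x Dx).
assert (H1 := Rle_abs (g x)); lra.
Qed.

Lemma limit1_const (D : R -> Prop) (l x0 : R) : limit1_in (fun _ => l) D l x0.
Proof. exact (limit_free (fun _ => l) D 0 x0). Qed.

Lemma limit_fourth_root_at_1 : limit1_in (fun x => sqrt (sqrt (1 - x))) I01 0 1.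
Proof.
intros eps Heps; exists (eps * eps * (eps * eps)); split.
{ repeat apply Rmult_lt_0_compat; assumption. }
intros x [[Hx0 Hx1] Hx]; simpl in *; unfold Rdist in *.
rewrite Rminus_0_r, Rabs_pos_eq by apply sqrt_pos.
rewrite Rabs_left in Hx by lra.
rewrite <- (sqrt_square eps), <- (sqrt_square (eps * eps)) by nra.
apply sqrt_lt_1; [apply sqrt_pos | apply sqrt_pos |].
apply sqrt_lt_1; [lra|nra|lra].
Qed.

Lemma limit_sqrt_at_1 : limit1_in (fun x => sqrt (1 - x)) I01 0 1.
Proof.
apply limit1_ext with (fun x => sqrt (sqrt (1 - x)) * sqrt (sqrt (1 - x))).
{ intros; apply sqrt_sqrt, sqrt_pos. }
rewrite <- (Rmult_0_l 0); apply limit_mul; apply limit_fourth_root_at_1.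
Qed.

(** With [z] the fourth root of [1 - x], the product is [4 (- z ln z) z], and [- z ln z <= 1]. *)
Lemma limit_ln_sqrt_at_1 : limit1_in (fun x => - ln (1 - x) * sqrt (1 - x)) I01 0 1.
Proof.
apply limit1_squeeze with (fun x => 4 * sqrt (sqrt (1 - x))).
2:{ rewrite <- (Rmult_0_r 4); apply limit_mul; [apply limit1_const|apply limit_fourth_root_at_1]. }
intros x [Hx0 Hx1]; rewrite Rminus_0_r.
set (s := sqrt (1 - x)); set (z := sqrt s).
assert (Hs : 0 < s) by (apply sqrt_lt_R0; lra).
assert (Hz : 0 < z) by (apply sqrt_lt_R0; assumption).
assert (Es : s * s = 1 - x) by (apply sqrt_sqrt; lra).
assert (Ez : z * z = s) by (apply sqrt_sqrt; lra).
assert (El : ln (1 - x) = 4 * ln z).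
{ rewrite <- Es, <- Ez, !ln_mult; try apply Rmult_lt_0_compat; try assumption; ring. }
assert (H := ln_ge_1_sub_inv z Hz).
assert (H0 : ln (1 - x) <= 0) by (assert (H' := ln_le_sub_1 (1 - x) ltac:(lra)); lra).
rewrite Rabs_pos_eq by (apply Rmult_le_pos; lra).
rewrite El, <- Ez.
assert (- ln z * z <= 1).
{ apply Rmult_le_compat_r with (r := z) in H; [|lra].
  replace ((1 - / z) * z) with (z - 1) in H by (field; lra); lra. }
replace (- (4 * ln z) * (z * z)) with (4 * (- ln z * z) * z) by ring.
apply Rle_trans with (4 * 1 * z); [apply Rmult_le_compat_r; lra|lra].
Qed.

(** First [K] is replaced by [w]: with [e1 = T / C] and [e2 = F / C - L], the difference [1 / w - L]
    is [(e2 + L (1 - e1)) / e1], which tends to [Rhat] since [L (1 - e1)] tends to 0. The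
    replacement costs [1 / w - 1 / K <= (K - w) / w^2], which is bounded by [d]. *)
Lemma limit_ratioH_at_1 (a b : R) (ha : 0 < a) (hb : 0 < b) (hab : a + b <= 1) :
  limit1_in (ratioH a b) I01 (Rhat a b) 1.
Proof.
assert (HC := hlim_pos a b ha hb).
set (L := fun x => - ln (1 - x)).
set (s := fun x => sqrt (1 - x)).
set (e1 := fun x => Tfun a b x / hlim a b).
set (e2 := fun x => hyp2F1 a b (a + b) x / hlim a b + ln (1 - x)).
assert (Le1 : limit1_in e1 I01 1 1).
{ apply limit1_squeeze with (fun x => 3 * (4 * (a * b) + 1) * s x).
  - intros x [Hx0 Hx1]; rewrite Rabs_minus_sym; apply Tfun_asymptotic; lra.
  - replace 0 with (3 * (4 * (a * b) + 1) * 0) by ring.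
    apply limit_mul; [apply limit1_const|apply limit_sqrt_at_1]. }
assert (Le2 : limit1_in e2 I01 (Rhat a b) 1).
{ apply limit1_squeeze with (fun x => 6 * (a * b) * s x).
  - intros x [Hx0 Hx1]; rewrite Rabs_minus_sym; apply hyp2F1_asymptotic; lra.
  - replace 0 with (6 * (a * b) * 0) by ring.
    apply limit_mul; [apply limit1_const|apply limit_sqrt_at_1]. }
assert (LLe1 : limit1_in (fun x => L x * (1 - e1 x)) I01 0 1).
{ apply limit1_squeeze with (fun x => 3 * (4 * (a * b) + 1) * (L x * s x)).
  - intros x [Hx0 Hx1]; rewrite Rminus_0_r, Rabs_mult.
    assert (0 <= L x) by (assert (H := ln_le_sub_1 (1 - x) ltac:(lra)); unfold L; lra).
    rewrite (Rabs_pos_eq (L x)) by assumption.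
    assert (H1 := Tfun_asymptotic a b x ha hb ltac:(lra)); fold (s x) (e1 x) in H1.
    replace (3 * (4 * (a * b) + 1) * (L x * s x)) with (L x * (3 * (4 * (a * b) + 1) * s x)) by ring.
    apply Rmult_le_compat_l; assumption.
  - replace 0 with (3 * (4 * (a * b) + 1) * 0) by ring.
    apply limit_mul; [apply limit1_const|apply limit_ln_sqrt_at_1]. }
assert (Lw : limit1_in (fun x => (e2 x + L x * (1 - e1 x)) * / e1 x) I01 (Rhat a b) 1).
{ replace (Rhat a b) with ((Rhat a b + 0) * / 1) by field.
  apply limit_mul; [apply limit_plus; assumption|apply limit_inv; [assumption|lra]]. }
(* This is [2 a b (1 - x) / (x w^2)]. The factor [1 - x] is split into two square roots, one for
   each [1 / w = (e2 + L) / e1], so that both products tend to 0. *)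
set (d := fun x => 2 * (a * b) * ((s x * e2 x + L x * s x) * / e1 x) *
    ((s x * e2 x + L x * s x) * / e1 x) * / x).
assert (Ld : limit1_in d I01 0 1).
{ assert (G : limit1_in (fun x => (s x * e2 x + L x * s x) * / e1 x) I01 0 1).
  { replace 0 with ((0 * Rhat a b + 0) * / 1) by field.
    apply limit_mul; [|apply limit_inv; [assumption|lra]].
    apply limit_plus; [apply limit_mul; [apply limit_sqrt_at_1|assumption]|apply limit_ln_sqrt_at_1]. }
  replace 0 with (2 * (a * b) * 0 * 0 * / 1) by field.
  repeat apply limit_mul; try apply limit1_const; try assumption.
  apply limit_inv; [apply lim_x|lra]. }
assert (Lr : limit1_in (fun x => (e2 x + L x * (1 - e1 x)) * / e1 x - ratioH a b x) I01 0 1).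
{ apply limit1_squeeze with d; [|exact Ld].
  intros x [Hx0 Hx1]; rewrite Rminus_0_r.
  assert (HF := hyp2F1_ge_1 a b x ha hb ltac:(lra)).
  assert (HT := Tfun_pos a b x ha hb ltac:(lra)).
  assert (Hw := wfun_pos a b x ha hb ltac:(lra)).
  assert (HK := Kfun_gt_wfun a b x ha hb hab ltac:(lra)).
  assert (H2w := two_wfun_le_half a b x ha hb hab ltac:(lra)).
  assert (Hwq := wfun_lt a b x ha hb ltac:(lra)).
  replace ((e2 x + L x * (1 - e1 x)) * / e1 x - ratioH a b x)
    with ((Kfun a b x - wfun a b x) * (/ wfun a b x * / Kfun a b x)).
  2:{ replace ((Kfun a b x - wfun a b x) * (/ wfun a b x * / Kfun a b x))
        with (/ wfun a b x - / Kfun a b x) by (field; lra).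
      unfold ratioH, e2, L, e1, wfun; field; repeat split; lra. }
  replace (d x) with (2 * (a * b) * (s x * s x) * / x * (/ wfun a b x * / wfun a b x)).
  2:{ unfold d, e2, L, e1, wfun; field; repeat split; lra. }
  assert (Es : s x * s x = 1 - x) by (apply sqrt_sqrt; lra).
  assert (Hi : / Kfun a b x <= / wfun a b x) by (apply Rinv_le_contravar; lra).
  assert (Hk : 0 < / Kfun a b x) by (apply Rinv_0_lt_compat; lra).
  assert (Hv : 0 < / wfun a b x) by (apply Rinv_0_lt_compat; lra).
  rewrite Rabs_pos_eq by (apply Rmult_le_pos; [lra|apply Rmult_le_pos; lra]).
  apply Rmult_le_compat; [lra|apply Rmult_le_pos; lra| |apply Rmult_le_compat_l; lra].
  rewrite Kfun_eq, Es by lra.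
  assert (Hx : 0 < / x) by (apply Rinv_0_lt_compat; lra).
  assert (Hi2 : / (1 - 2 * wfun a b x) <= 2).
  { replace 2 with (/ (1 / 2)) at 2 by field; apply Rinv_le_contravar; lra. }
  assert (Hi3 : 0 < / (1 - 2 * wfun a b x)) by (apply Rinv_0_lt_compat; lra).
  set (v := / (1 - 2 * wfun a b x)) in *.
  unfold Rdiv; fold v.
  replace (wfun a b x + (1 - x) * ((a * b - (a + b) * wfun a b x) * / x) * v - wfun a b x)
    with ((1 - x) * / x * ((a * b - (a + b) * wfun a b x) * v)) by ring.
  replace (2 * (a * b) * (1 - x) * / x) with ((1 - x) * / x * (a * b * 2)) by ring.
  apply Rmult_le_compat_l; [apply Rmult_le_pos; lra|].
  assert (0 < (a + b) * wfun a b x) by (apply Rmult_lt_0_compat; lra).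
  apply Rmult_le_compat; lra. }
apply limit1_ext with (fun x => (e2 x + L x * (1 - e1 x)) * / e1 x -
  ((e2 x + L x * (1 - e1 x)) * / e1 x - ratioH a b x)).
{ intros; ring. }
replace (Rhat a b) with (Rhat a b - 0) by ring.
apply limit_minus; assumption.
Qed.

Lemma inv_Kfun_at_0 (a b : R) (ha : 0 < a) (hb : 0 < b) (hab : a + b <= 1) :
  / Kfun a b 0 = cab a b.
Proof.
assert (hpq := prod_le_quarter_sq a b).
assert (hq : 0 < a * b) by (apply Rmult_lt_0_compat; assumption).
assert (hA : 0 < (a + b) - 2 * (a * b)) by (simpl in hpq; nra).
assert (H1 : 0 < (a + b + 1) * (a + b - 2 * a * b)) by (apply Rmult_lt_0_compat; lra).
assert (H2 : 0 < a * b * (a + b)) by (apply Rmult_lt_0_compat; lra).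
assert (E : Kfun a b 0 = a * b * ((a + b + 1) * (a + b - 2 * a * b) + a * b * (a + b)) /
   ((a + b) * (a + b - 2 * a * b) * (a + b + 1))).
{ unfold Kfun; rewrite wfun_at_0, hyp2F1_at_0, Tfun'_at_0 by assumption.
  field; repeat split; lra. }
rewrite E; unfold cab; field; repeat split; lra.
Qed.

(** The formula for [ratioH] is differentiable at 0 itself, so the limit is its value there. *)
Lemma limit_ratioH_at_0 (a b : R) (ha : 0 < a) (hb : 0 < b) (hab : a + b <= 1) :
  limit1_in (ratioH a b) I01 (cab a b) 0.
Proof.
assert (HK := Kfun_gt_wfun a b 0 ha hb hab ltac:(lra)).
assert (Hw := wfun_pos a b 0 ha hb ltac:(lra)).
assert (H2w := two_wfun_le_half a b 0 ha hb hab ltac:(lra)).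
assert (HF := hyp2F1_ge_1 a b 0 ha hb ltac:(lra)).
assert (E : cab a b = ratioH a b 0).
{ unfold ratioH; rewrite inv_Kfun_at_0, Rminus_0_r, ln_1 by assumption; ring. }
rewrite E.
apply limit1_imp with (D_x no_cond 0).
{ intros x [Hx0 Hx1]; split; [exact I|lra]. }
change (continuity_pt (ratioH a b) 0).
apply derivable_continuous_pt, ex_derive_Reals_0.
assert (H0 : Rabs 0 < 1) by (rewrite Rabs_R0; lra).
assert (D1 : ex_derive (wfun a b) 0) by (eexists; apply is_derive_wfun; auto; lra).
assert (D2 : ex_derive (Tfun' a b) 0) by (eexists; apply is_derive_Tfun'; auto).
assert (D3 : ex_derive (hyp2F1 a b (a + b)) 0) by (eexists; apply is_derive_hyp2F1; auto).
assert (DK : ex_derive (Kfun a b) 0).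
{ unfold Kfun; auto_derive; repeat split; auto; lra. }
unfold ratioH; auto_derive; repeat split; auto; lra.
Qed.

(** * Derivatives of [phi] and the two equivalences *)

Definition phi' (a b c x : R) : R :=
  (1 - (c - ln (1 - x)) * wfun a b x) / ((1 - x) * hyp2F1 a b (a + b) x).

Definition phi'' (a b c x : R) : R :=
  (1 - 2 * wfun a b x) * Kfun a b x / ((1 - x) ^ 2 * hyp2F1 a b (a + b) x) *
  (ratioH a b x - c).

Lemma is_derive_phi (a b c x : R) (ha : 0 < a) (hb : 0 < b) (hx : 0 < x < 1) :
  is_derive (phi a b c) x (phi' a b c x).
Proof.
assert (HF := hyp2F1_ge_1 a b x ha hb ltac:(lra)).
assert (D := is_derive_hyp2F1 a b x ha hb ltac:(rewrite Rabs_pos_eq; lra)).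
unfold phi; auto_derive.
- repeat split; try lra; eexists; exact D.
- replace (Derive (fun x0 => hyp2F1 a b (a + b) x0) x) with (Tfun a b x / (1 - x))
    by (symmetry; apply is_derive_unique, D).
  unfold phi', wfun, Rminus; field; lra.
Qed.

Lemma is_derive_phi' (a b c x : R) (ha : 0 < a) (hb : 0 < b) (hab : a + b <= 1)
  (hx : 0 < x < 1) : is_derive (phi' a b c) x (phi'' a b c x).
Proof.
assert (HF := hyp2F1_ge_1 a b x ha hb ltac:(lra)).
assert (D := is_derive_hyp2F1 a b x ha hb ltac:(rewrite Rabs_pos_eq; lra)).
assert (Dw := is_derive_wfun a b x ha hb ltac:(lra)).
assert (Hw := wfun_pos a b x ha hb ltac:(lra)).
assert (HK := Kfun_gt_wfun a b x ha hb hab ltac:(lra)).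
assert (H2w := two_wfun_le_half a b x ha hb hab ltac:(lra)).
assert (HT : Tfun a b x = wfun a b x * hyp2F1 a b (a + b) x) by (unfold wfun; field; lra).
assert (E2 : phi'' a b c x = ((1 - 2 * wfun a b x) -
   ((1 - 2 * wfun a b x) * Kfun a b x) * (c - ln (1 - x))) /
   ((1 - x) ^ 2 * hyp2F1 a b (a + b) x)).
{ unfold phi'', ratioH; field; repeat split; lra. }
rewrite E2; replace ((1 - 2 * wfun a b x) * Kfun a b x) with ((1 - 2 * wfun a b x) * wfun a b x
   + (1 - x) * (Tfun' a b x / hyp2F1 a b (a + b) x)) by (unfold Kfun; field; lra).
unfold phi'; auto_derive.
- repeat split; try lra; try (eexists; eassumption).
  apply Rmult_integral_contrapositive; lra.
- replace (Derive (fun x0 => hyp2F1 a b (a + b) x0) x) with (Tfun a b x / (1 - x))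
    by (symmetry; apply is_derive_unique, D).
  replace (Derive (fun x0 => wfun a b x0) x) with (wfun' a b x)
    by (symmetry; apply is_derive_unique, Dw).
  rewrite HT; unfold wfun', Rminus; field; lra.
Qed.

Lemma phi''_factor_pos (a b x : R) (ha : 0 < a) (hb : 0 < b) (hab : a + b <= 1) (hx : 0 < x < 1) :
  0 < (1 - 2 * wfun a b x) * Kfun a b x / ((1 - x) ^ 2 * hyp2F1 a b (a + b) x).
Proof.
assert (HF := hyp2F1_ge_1 a b x ha hb ltac:(lra)).
assert (Hw := wfun_pos a b x ha hb ltac:(lra)).
assert (HK := Kfun_gt_wfun a b x ha hb hab ltac:(lra)).
assert (H2w := two_wfun_le_half a b x ha hb hab ltac:(lra)).
apply Rdiv_lt_0_compat; apply Rmult_lt_0_compat; try apply pow_lt; lra.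
Qed.

Lemma phi_strict_convex_on (a b c lo hi : R) (ha : 0 < a) (hb : 0 < b) (hab : a + b <= 1)
  (hlo : 0 <= lo) (hhi : hi <= 1) (hH : forall x, lo < x < hi -> c < ratioH a b x) :
  forall x y t, lo < x < hi -> lo < y < hi -> x <> y -> 0 < t < 1 ->
    phi a b c (t * x + (1 - t) * y) < t * phi a b c x + (1 - t) * phi a b c y.
Proof.
apply strict_convex_of_second_derivative with (phi' a b c) (phi'' a b c); intros x Hx.
- apply is_derive_phi; auto; lra.
- apply is_derive_phi'; auto; lra.
- apply Rmult_lt_0_compat; [apply phi''_factor_pos; auto; lra|].
  specialize (hH x Hx); lra.
Qed.

Lemma phi_strict_concave_on (a b c lo hi : R) (ha : 0 < a) (hb : 0 < b) (hab : a + b <= 1)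
  (hlo : 0 <= lo) (hhi : hi <= 1) (hH : forall x, lo < x < hi -> ratioH a b x < c) :
  forall x y t, lo < x < hi -> lo < y < hi -> x <> y -> 0 < t < 1 ->
    t * phi a b c x + (1 - t) * phi a b c y < phi a b c (t * x + (1 - t) * y).
Proof.
apply strict_concave_of_second_derivative with (phi' a b c) (phi'' a b c); intros x Hx.
- apply is_derive_phi; auto; lra.
- apply is_derive_phi'; auto; lra.
- apply Rmult_pos_neg; [apply phi''_factor_pos; auto; lra|].
  specialize (hH x Hx); lra.
Qed.

(** Passing to the limit at 1 gives only a weak inequality; the intermediate point [y] and strict
    decrease make it strict, which is what admits [c = Rhat a b]. *)
Lemma ratioH_gt_Rhat (a b x : R) (ha : 0 < a) (hb : 0 < b) (hab : a + b <= 1)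
  (hx : 0 < x < 1) : Rhat a b < ratioH a b x.
Proof.
set (y := (x + 1) / 2); assert (Hy : x < y < 1) by (unfold y; lra).
assert (H1 := ratioH_decreasing a b x y ha hb hab ltac:(lra) ltac:(lra) ltac:(lra)).
apply Rle_lt_trans with (ratioH a b y); [|exact H1].
apply Rnot_lt_le; intros Hlt.
destruct (limit_ratioH_at_1 a b ha hb hab (Rhat a b - ratioH a b y) ltac:(lra)) as (d & Hd & H).
set (z := Rmax ((y + 1) / 2) (1 - d / 2)).
assert (Hz1 : (y + 1) / 2 <= z) by apply Rmax_l.
assert (Hz2 : 1 - d / 2 <= z) by apply Rmax_r.
assert (Hz3 : z < 1) by (apply Rmax_lub_lt; lra).
specialize (H z); simpl in H; unfold Rdist, I01 in H.
rewrite (Rabs_left (z - 1)) in H by lra.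
specialize (H ltac:(repeat split; lra)); apply Rabs_def2 in H.
assert (H2 := ratioH_decreasing a b y z ha hb hab ltac:(lra) ltac:(lra) ltac:(lra)); lra.
Qed.

Lemma ratioH_lt_cab (a b x : R) (ha : 0 < a) (hb : 0 < b) (hab : a + b <= 1)
  (hx : 0 < x < 1) : ratioH a b x < cab a b.
Proof.
set (y := x / 2); assert (Hy : 0 < y < x) by (unfold y; lra).
assert (H1 := ratioH_decreasing a b y x ha hb hab ltac:(lra) ltac:(lra) ltac:(lra)).
apply Rlt_le_trans with (ratioH a b y); [exact H1|].
apply Rnot_lt_le; intros Hlt.
destruct (limit_ratioH_at_0 a b ha hb hab (ratioH a b y - cab a b) ltac:(lra)) as (d & Hd & H).
set (z := Rmin (y / 2) (d / 2)).
assert (Hz1 : z <= y / 2) by apply Rmin_l.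
assert (Hz2 : z <= d / 2) by apply Rmin_r.
assert (Hz3 : 0 < z) by (apply Rmin_glb_lt; lra).
specialize (H z); simpl in H; unfold Rdist, I01 in H.
rewrite Rminus_0_r, (Rabs_pos_eq z) in H by lra.
specialize (H ltac:(repeat split; lra)); apply Rabs_def2 in H.
assert (H2 := ratioH_decreasing a b z y ha hb hab ltac:(lra) ltac:(lra) ltac:(lra)); lra.
Qed.

Theorem theorem1 (a b c : R) (ha : 0 < a) (hb : 0 < b) (hab : a + b <= 1)
  (hc : 0 <= c) :
  (strictly_convex_01 (phi a b c) <-> c <= ramanujanR a b) /\
  (strictly_concave_01 (phi a b c) <-> cab a b <= c).
Proof.
rewrite <- (Rhat_ramanujan a b) by lra.
split; split.
(* If [c] exceeds the limit at 1, then [ratioH < c] on some [(lo, 1)], so [phi] is strictly concave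
   there; the midpoint of [x] and [y] gives the contradiction. *)
- intros Hconv; apply Rnot_lt_le; intros Hlt.
  destruct (limit_ratioH_at_1 a b ha hb hab (c - Rhat a b) ltac:(lra)) as (d & Hd & H).
  set (lo := Rmax 0 (1 - d)).
  assert (Hlo0 : 0 <= lo) by apply Rmax_l.
  assert (Hlod : 1 - d <= lo) by apply Rmax_r.
  assert (Hlo1 : lo < 1) by (apply Rmax_lub_lt; lra).
  set (x := (2 * lo + 1) / 3); set (y := (lo + 2) / 3).
  assert (Hx : lo < x < 1) by (unfold x; lra).
  assert (Hy : lo < y < 1) by (unfold y; lra).
  assert (Hxy : x <> y) by (unfold x, y; lra).
  assert (H1 := phi_strict_concave_on a b c lo 1 ha hb hab Hlo0 (Rle_refl 1)).
  assert (H2 := Hconv x y (1 / 2) ltac:(lra) ltac:(lra) Hxy ltac:(lra)).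
  assert (H3 : forall z, lo < z < 1 -> ratioH a b z < c).
  { intros z Hz; specialize (H z); simpl in H; unfold Rdist, I01 in H.
    rewrite (Rabs_left (z - 1)) in H by lra.
    specialize (H ltac:(repeat split; lra)); apply Rabs_def2 in H; lra. }
  specialize (H1 H3 x y (1 / 2) Hx Hy Hxy ltac:(lra)); lra.
- intros Hle x y t; apply (phi_strict_convex_on a b c 0 1); auto; try lra.
  intros z Hz; apply Rle_lt_trans with (1 := Hle), ratioH_gt_Rhat; assumption.
(* The mirror argument at 0: if [c < cab a b], then [phi] is strictly convex on some [(0, hi)]. *)
- intros Hconc; apply Rnot_lt_le; intros Hlt.
  destruct (limit_ratioH_at_0 a b ha hb hab (cab a b - c) ltac:(lra)) as (d & Hd & H).
  set (hi := Rmin 1 d).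
  assert (Hhi1 : hi <= 1) by apply Rmin_l.
  assert (Hhid : hi <= d) by apply Rmin_r.
  assert (Hhi0 : 0 < hi) by (apply Rmin_glb_lt; lra).
  set (x := hi / 3); set (y := hi / 2).
  assert (Hx : 0 < x < hi) by (unfold x; lra).
  assert (Hy : 0 < y < hi) by (unfold y; lra).
  assert (Hxy : x <> y) by (unfold x, y; lra).
  assert (H1 := phi_strict_convex_on a b c 0 hi ha hb hab (Rle_refl 0) Hhi1).
  assert (H2 := Hconc x y (1 / 2) ltac:(lra) ltac:(lra) Hxy ltac:(lra)).
  assert (H3 : forall z, 0 < z < hi -> c < ratioH a b z).
  { intros z Hz; specialize (H z); simpl in H; unfold Rdist, I01 in H.
    rewrite Rminus_0_r, (Rabs_pos_eq z) in H by lra.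
    specialize (H ltac:(repeat split; lra)); apply Rabs_def2 in H; lra. }
  specialize (H1 H3 x y (1 / 2) Hx Hy Hxy ltac:(lra)); lra.
- intros Hle x y t; apply (phi_strict_concave_on a b c 0 1); auto; try lra.
  intros z Hz; eapply Rlt_le_trans; [apply ratioH_lt_cab; assumption|exact Hle].
Qed.
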